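(* Let $n\in\mathbb{Z}_{\ge1}$ and let $k_1,\ldots,k_n\in\mathbb{Z}_{\ge1}$ be such that $k_i\ge2$ for some $i\in\{1,\ldots,n\}$. Put $k:=k_1+\cdots+k_n$. Then for all $\alpha,\beta\in\mathbb{C}$ with $\mathrm{Re}(\alpha)>0$ and $\beta\notin\mathbb{Z}_{\le0}$: (i) \[ \sum_{i=1}^{n}\sum_{j=0}^{k_i-2}Z_{I}(j+1,k_{i+1},\ldots,k_n,k_1,\ldots,k_{i-1},k_i-j;(\alpha,\beta)) =\sum_{i=1}^{n}Z_{II}(k_{i+1},\ldots,k_n,k_1,\ldots,k_{i-1},k_i+1;(\alpha,\beta)), \] (ii) \[ \sum_{i=1}^{n}\sum_{j=0}^{k_i-2}Z^{\star}_{I}(j+1,k_{i+1},\ldots,k_n,k_1,\ldots,k_{i-1},k_i-j;(\alpha,\beta)) =(k-n)Z(n|k-n+1;(\alpha,\beta))+nZ(n+1|k-n;(\alpha,\beta)). \] Here the empty sum $\sum_{j=0}^{-1}$ is $0$, and for a fixed $i$ the index $(k_{i+1},\ldots,k_n,k_1,\ldots,k_{i-1})$ denotes the cyclic list of the $k$'s other than $k_i$ starting after $k_i$ (for $i=n$ it is $(k_1,\ldots,k_{n-1})$; for $n=1$ it is empty).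
   Context: $(a)_m$ is the Pochhammer symbol: $(a)_0=1$, $(a)_m=a(a+1)\cdots(a+m-1)$ for $m\ge1$. Let $\alpha,\beta\in\mathbb{C}$ with $\mathrm{Re}(\alpha)>0$, $\beta\notin\mathbb{Z}_{\le0}$. For $r\ge1$, $k_1,\ldots,k_{r-1}\in\mathbb{Z}_{\ge1}$, $k_r\in\mathbb{Z}_{\ge2}$, define \[ Z_{I}(k_1,\ldots,k_r;(\alpha,\beta)):=\sum_{0\le m_1<\cdots<m_r<\infty}\frac{(\alpha)_{m_1}}{m_1!}\frac{m_r!}{(\alpha)_{m_r}}\frac{1}{(m_1+\beta)^{k_1}}\prod_{i=2}^{r}\frac{1}{(m_i+\alpha)(m_i+\beta)^{k_i-1}}, \] \[ Z_{II}(k_1,\ldots,k_r;(\alpha,\beta)):=\sum_{0\le m_1<\cdots<m_r<\infty}\frac{(\alpha)_{m_1}}{m_1!}\frac{m_r!}{(\alpha)_{m_r}}\left\{\prod_{i=1}^{r-1}\frac{1}{(m_i+\alpha)(m_i+\beta)^{k_i-1}}\right\}\frac{1}{(m_r+\alpha)^2(m_r+\beta)^{k_r-2}}, \] \[ Z^{\star}_{I}(k_1,\ldots,k_r;(\alpha,\beta)):=\sum_{0\le m_1\le\cdots\le m_r<\infty}\frac{(\alpha)_{m_1}}{m_1!}\frac{m_r!}{(\alpha)_{m_r}}\frac{1}{(m_1+\beta)^{k_1}}\prod_{i=2}^{r}\frac{1}{(m_i+\alpha)(m_i+\beta)^{k_i-1}}, \] and for $a,b\in\mathbb{Z}$ with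 $a+b\ge2$, \[ Z(a|b;(\alpha,\beta)):=\sum_{m=0}^{\infty}\frac{1}{(m+\alpha)^{a}(m+\beta)^{b}}. \] *)

(* Defs.v *)
(* The complex numbers are R[i], for R : realType. *)
From HB Require Import structures.
From mathcomp Require Export all_boot all_order all_algebra.
From mathcomp Require Export complex.
From mathcomp Require Export all_classical all_reals all_analysis.

Set Implicit Arguments.
Unset Strict Implicit.
Unset Printing Implicit Defensive.

Export Order.TTheory GRing.Theory Num.Theory.
Export numFieldNormedType.Exports.

#[export] Set Implicit Arguments.
#[export] Unset Strict Implicit.
#[export] Unset Printing Implicit Defensive.

Local Open Scope ring_scope.
Local Open Scope complex_scope.

Section Defs.
Context {R : realType}.
Implicit Types (a b : R[i]) (ks ms : seq nat).

Definition poch a (m : nat) : R[i] := \prod_(l < m) (a + l%:R).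

(* The sum of F [:: m_1; ...; m_r] over the e-chains 0 <= m_1 e ... e m_r < oo
   in nat (e = ltn or leq), as the limit of the finite sums over the chains
   bounded by N. The regular module R[i]^o carries the usual topology of the
   complex plane. *)
Definition chain_sum (e : rel nat) (r : nat) (F : seq nat -> R[i]) : R[i] :=
  limn (fun N : nat =>
    (\sum_(m : r.-tuple 'I_N | sorted e [seq val l | l <- m])
        F [seq val l | l <- m]) : R[i]^o).

(* An index (k_1, ..., k_r) is the list ks of size r >= 1; entry number i of
   ks and ms (counted from 0) is k_(i+1) and m_(i+1). The exponents k_i - 1 and
   k_r - 2 are truncated differences: the intended domain is k_i >= 1 and
   k_r >= 2. *)

Definition ratio_factor a ms : R[i] :=
  let m1 := head 0%N ms in let mr := last 0%N ms in
  (poch a m1 / m1`!%:R) * (mr`!%:R / poch a mr).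

Definition termI a b ks ms : R[i] :=
  ratio_factor a ms
  * (1 / ((nth 0%N ms 0)%:R + b) ^+ nth 0%N ks 0)
  * \prod_(1 <= i < size ks)
      (1 / (((nth 0%N ms i)%:R + a) * ((nth 0%N ms i)%:R + b) ^+ (nth 0%N ks i - 1))).

Definition termII a b ks ms : R[i] :=
  let r := size ks in
  ratio_factor a ms
  * (\prod_(0 <= i < r.-1)
      (1 / (((nth 0%N ms i)%:R + a) * ((nth 0%N ms i)%:R + b) ^+ (nth 0%N ks i - 1))))
  * (1 / (((nth 0%N ms r.-1)%:R + a) ^+ 2
          * ((nth 0%N ms r.-1)%:R + b) ^+ (nth 0%N ks r.-1 - 2))).

Definition ZI ks a b : R[i] := chain_sum ltn (size ks) (termI a b ks).

Definition ZII ks a b : R[i] := chain_sum ltn (size ks) (termII a b ks).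

Definition ZstarI ks a b : R[i] := chain_sum leq (size ks) (termI a b ks).

Definition Zab (p q : int) a b : R[i] :=
  limn (series (fun m : nat =>
    (1 / ((m%:R + a) ^ p * (m%:R + b) ^ q)) : R[i]^o)).

End Defs.

(* (k_(i+1), ..., k_n, k_1, ..., k_(i-1)), with i counted from 0 *)
Definition cyc_others (ks : seq nat) (i : nat) : seq nat :=
  drop i.+1 ks ++ take i ks.

(* Main.v *)
Require Import Defs.
From mathcomp Require Import zify ring lra.

Local Open Scope ring_scope.
Local Open Scope complex_scope.

(** Write [u_m = (a)_m / m!] and [w_m = u_m (m + a)].  Summing the geometric
progression in [j] turns the left-hand sides into sums over chains
[p, m_2, ..., m_n, q] with a kernel [1 / (q - p)]; this splits into one sum in
which [q] is free and one in which [p] is free, both weighted by the same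
product of factors [1 / ((m + a) (m + b)^(k-1))] attached to consecutive
rotations of the index.  Hence after the cyclic summation only the difference of
the two one-variable sums remains.  Truncated at [q <= M], that difference is
computed exactly by a telescoping in the last variable: it equals the summand of
the right-hand side minus [ker_err M], which depends only on [m_1].

Convergence and the vanishing of the error rest on the bound
[|u_p / w_q| <= 1 / (s * rise s q)] for [p <= q], with [s = min (Re a, 1)] and
[rise s q = prod_(1 <= l <= q) (1 + s / l)], and on the fact that [rise s] outgrows
every power of the harmonic sums. *)

(** * Iterated sums over lists of naturals below a bound *)

Section ListSum.
Context {V : zmodType}.
Implicit Types (F G : seq nat -> V) (r N : nat).

(** The tuple sums of [chain_sum] in nested form (see [sum_tupleE]), so that the first or the last
    variable can be split off by induction on [r]. *)
Fixpoint list_sum r N F : V :=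
  if r is r'.+1 then \sum_(0 <= m < N) list_sum r' N (fun ms => F (m :: ms))
  else F [::].

Lemma eq_list_sum r N F G :
    (forall ms, size ms = r -> all (gtn N) ms -> F ms = G ms) ->
  list_sum r N F = list_sum r N G.
Proof.
elim: r F G => [|r IH] F G FG /=; first exact: FG.
apply: eq_big_nat => m /andP[_ mN]; apply: IH => ms rms Nms.
by apply: FG => /=; rewrite ?rms // mN.
Qed.

Lemma list_sum_sum (I : Type) (s : seq I) (P : pred I) r N
    (F : I -> seq nat -> V) :
  list_sum r N (fun ms => \sum_(i <- s | P i) F i ms)
  = \sum_(i <- s | P i) list_sum r N (F i).
Proof.
elim: r F => [//|r IH] F /=; under eq_bigr do rewrite IH.
by rewrite exchange_big.
Qed.

Lemma list_sumB r N F G :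
  list_sum r N (fun ms => F ms - G ms) = list_sum r N F - list_sum r N G.
Proof.
elim: r F G => [//|r IH] F G /=; under eq_bigr do rewrite IH.
by rewrite sumrB.
Qed.

Lemma list_sumD r N F G :
  list_sum r N (fun ms => F ms + G ms) = list_sum r N F + list_sum r N G.
Proof.
elim: r F G => [//|r IH] F G /=; under eq_bigr do rewrite IH.
by rewrite big_split.
Qed.

Lemma list_sum0 r N : list_sum r N (fun=> 0) = 0.
Proof. by elim: r => [//|r IH] /=; rewrite big1. Qed.

Lemma list_sum_cons r N F :
  list_sum r.+1 N F = list_sum r N (fun ms => \sum_(0 <= p < N) F (p :: ms)).
Proof. by rewrite list_sum_sum. Qed.

Lemma list_sum_rcons r N F :
  list_sum r.+1 N F = list_sum r N (fun ms => \sum_(0 <= q < N) F (rcons ms q)).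
Proof.
elim: r F => [//|r IH] F; rewrite [LHS]/= [RHS]/=.
by apply: eq_bigr => m _; exact: (IH (fun ms => F (m :: ms))).
Qed.

(** Brings sums with different bounds to the same range, where they can be compared term by term. *)
Lemma list_sum_all_lt r M N F : (M <= N)%N ->
  list_sum r N (fun ms => if all (gtn M) ms then F ms else 0)
  = list_sum r M F.
Proof.
move=> MN; elim: r F => [//|r IH] F /=.
rewrite (@big_cat_nat _ _ _ M) //= [X in _ + X]big1_seq ?addr0; last first.
  move=> m /=; rewrite mem_index_iota => /andP[Mm _].
  by rewrite ltnNge Mm /= list_sum0.
by apply: eq_big_nat => m /andP[_ mM]; rewrite mM IH.
Qed.

Lemma list_sum_all_eq r N F a : (a < N)%N ->
  list_sum r N (fun ms => if all (pred1 a) ms then F ms else 0) = F (nseq r a).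
Proof.
move=> aN; elim: r F => [//|r IH] F /=.
rewrite (bigD1_seq a) ?mem_index_iota ?iota_uniq //= big1 ?addr0.
  by rewrite eqxx IH.
by move=> m /negPf -> /=; rewrite list_sum0.
Qed.

Lemma list_sum_constant r N F :
  list_sum r.+1 N (fun ms => if all (pred1 (head 0%N ms)) ms then F ms else 0)
  = \sum_(0 <= a < N) F (nseq r.+1 a).
Proof.
rewrite [LHS]/=; apply: eq_big_nat => a /andP[_ aN].
rewrite -[RHS](list_sum_all_eq r (fun ms => F (a :: ms)) aN).
by apply: eq_list_sum => ms _ _; rewrite /= eqxx.
Qed.

Lemma sum_tupleE r N (P : pred (seq nat)) F :
  \sum_(m : r.-tuple 'I_N | P [seq val l | l <- m]) F [seq val l | l <- m]
  = list_sum r N (fun ms => if P ms then F ms else 0).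
Proof.
elim: r P F => [|r IH] P F /=.
  rewrite (eq_bigl (fun=> P [::])); last by move=> m; rewrite tuple0.
  rewrite big_mkcond (eq_bigr (fun=> if P [::] then F [::] else 0)).
    by rewrite sumr_const card_tuple expn0.
  by move=> m _; rewrite tuple0.
rewrite big_mkord.
rewrite (reindex (fun p : 'I_N * r.-tuple 'I_N => cons_tuple p.1 p.2)) /=.
  rewrite -(pair_big_dep xpredT
    (fun (i : 'I_N) (t : r.-tuple 'I_N) => P (val i :: [seq val l | l <- t]))
    (fun (i : 'I_N) (t : r.-tuple 'I_N) => F (val i :: [seq val l | l <- t]))).
  apply: eq_bigr => i _.
  exact: (IH (fun ms => P (val i :: ms)) (fun ms => F (val i :: ms))).
exists (fun t : r.+1.-tuple 'I_N => (thead t, [tuple of behead t])).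
  by move=> [i t] _ /=; congr pair; apply: val_inj.
by move=> t _; rewrite [RHS]tuple_eta; apply: val_inj.
Qed.

End ListSum.

Lemma list_sum_raddf {U V : zmodType} (f : {additive U -> V}) r N
    (F : seq nat -> U) :
  f (list_sum r N F) = list_sum r N (fun ms => f (F ms)).
Proof.
elim: r F => [//|r IH] F /=; rewrite raddf_sum.
by apply: eq_bigr => m _; rewrite IH.
Qed.

Lemma list_sumZ {R : comNzRingType} (c : R) r N F :
  list_sum r N (fun ms => c * F ms) = c * list_sum r N F.
Proof.
elim: r F => [//|r IH] F /=; under eq_bigr do rewrite IH.
by rewrite mulr_sumr.
Qed.

Lemma list_sum_prod {R : comNzRingType} r N (h : nat -> R) :
  list_sum r N (fun ms => \prod_(m <- ms) h m) = (\sum_(0 <= m < N) h m) ^+ r.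
Proof.
elim: r => [|r IH] /=; first by rewrite big_nil.
rewrite exprS -IH mulr_suml; apply: eq_bigr => m _.
by rewrite -list_sumZ; apply: eq_list_sum => ms _ _; rewrite big_cons.
Qed.

Section ListSumOrder.
Context {R : numDomainType}.
Implicit Types (F G : seq nat -> R) (r N : nat).

Lemma le_list_sum r N F G :
    (forall ms, size ms = r -> all (gtn N) ms -> F ms <= G ms) ->
  list_sum r N F <= list_sum r N G.
Proof.
elim: r F G => [|r IH] F G FG /=; first exact: FG.
apply: ler_sum_nat => m /andP[_ mN]; apply: IH => ms rms Nms.
by apply: FG => /=; rewrite ?rms // mN.
Qed.

Lemma norm_list_sum (V : normedZmodType R) r N (F : seq nat -> V) :
  `|list_sum r N F| <= list_sum r N (fun ms => `|F ms|).
Proof.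
elim: r F => [//|r IH] F /=; apply: le_trans (ler_norm_sum _ _ _) _.
by apply: ler_sum => m _; apply: IH.
Qed.

(** Both increments run over the same lists, those with an entry outside the smaller range, so the
    termwise bound passes to them. This is the form of domination that [is_cvg_complex_dominated]
    asks for. *)
Lemma norm_list_sumB (V : normedZmodType R) r M N (F : seq nat -> V) G :
    (M <= N)%N ->
    (forall ms, size ms = r -> `|F ms| <= G ms) ->
  `|list_sum r N F - list_sum r M F| <= list_sum r N G - list_sum r M G.
Proof.
move=> MN FG; rewrite -!(list_sum_all_lt _ _ MN) -!list_sumB.
apply: le_trans (norm_list_sum _ _ _) _; apply: le_list_sum => ms rms _.
by case: ifP => _; rewrite ?subrr ?normr0 // !subr0 FG.
Qed.

End ListSumOrder.

(** All entries of a weakly increasing list lie between the first and the last one. This reduces the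
    diagonal terms of the star sums to one-variable series. *)
Lemma sorted_leq_headP ms : sorted leq ms ->
  (head 0 ms == last 0 ms)%N = all (pred1 (head 0%N ms)) ms.
Proof.
case: ms => [//|p s] /= ps; rewrite eqxx /=; apply/eqP/idP => [e|/allP sp].
  apply/allP => m ms /=; rewrite eqn_leq.
  have := order_path_min leq_trans ps => /allP /(_ _ ms) ->; rewrite andbT.
  case/splitPr: ms ps e => s1 s2; rewrite cat_path last_cat /= => /and3P[_ _ ms2] ->.
  case: s2 ms2 => [//|x s2] ms2.
  by have /allP/(_ (last x s2)) := order_path_min leq_trans ms2; apply; apply: mem_last.
by case: s ps sp => [//|x s] _ sp; apply/esym/eqP/sp/mem_last.
Qed.

(** * Telescoping of the kernel $1/(q-p)$ *)

Section Kernel.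
Context {F : numFieldType} (u : nat -> F) (a : F).
Hypothesis u_neq0 : forall m, u m != 0.
Hypothesis a_neq0 : forall m, m%:R + a != 0.
Hypothesis uS : forall m, u m.+1 * m.+1%:R = u m * (m%:R + a).

Definition weight m := u m * (m%:R + a).
(** Since [x / 0 = 0], this kernel and [kerB] take the value 0 at [p = q]; the diagonal is accounted
    for separately in [sum_termI] and [kernel_leq]. *)
Definition kerA p q := u p * (p%:R + a) / (weight q * (q%:R - p%:R)).
Definition kerB p q := u p / (u q * (q%:R - p%:R)).
(** The value at [b = M] of the expression that telescopes in [sum_kerA]. *)
Definition ker_err M m := \sum_(0 <= p < m) kerB p M + u m / weight M.

Lemma uSE m : u m.+1 = u m * (m%:R + a) / m.+1%:R.
Proof. by rewrite -uS mulfK // pnatr_eq0. Qed.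

Lemma natrB_neq0 p q : (p < q)%N -> q%:R - p%:R != 0 :> F.
Proof. by move=> pq; rewrite subr_eq0 eqr_nat neq_ltn pq orbT. Qed.

Lemma sum_kerB_diff m b : (m <= b)%N ->
  \sum_(0 <= p < m) (kerB p b - kerB p b.+1)
  = m%:R * u m / (weight b * (b.+1%:R - m%:R)).
Proof.
elim: m => [|m IH] mb; first by rewrite big_geq // !mul0r.
rewrite big_nat_recr //= IH ?(ltnW mb) // /kerB /weight !uSE.
have n1 : b%:R + 1 != 0 :> F by rewrite natr1 pnatr_eq0.
have n2 : m%:R + 1 != 0 :> F by rewrite natr1 pnatr_eq0.
have n3 : b%:R - m%:R != 0 :> F by apply: natrB_neq0.
have n4 : b%:R + 1 - m%:R != 0 :> F by rewrite natr1; apply/natrB_neq0/ltnW.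
have := u_neq0 b; have := a_neq0 b.
rewrite -!natr1 => n5 n6; field.
by rewrite n1 n2 n4 n5 n6 opprD addrACA subrr addr0 n3.
Qed.

(** The fraction is the one from [sum_kerB_diff]. Hence, if $G(b)$ denotes the sum of [kerB p b]
    over $p<m$ plus $u_m/w_b$, then $G(b)-G(b+1)$ is [kerA m b.+1]. *)
Lemma kerA_diff m b : (m <= b)%N ->
  kerA m b.+1 + u m / weight b.+1
  = m%:R * u m / (weight b * (b.+1%:R - m%:R)) + u m / weight b.
Proof.
move=> mb; rewrite /kerA /weight uSE.
have n1 : b%:R + 1 != 0 :> F by rewrite natr1 pnatr_eq0.
have n4 : b%:R + 1 - m%:R != 0 :> F by rewrite natr1; apply/natrB_neq0.
have n2 := a_neq0 b.+1; have := u_neq0 b; have := a_neq0 b.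
move: n2; rewrite -!natr1 => n2 n5 n6; field.
by rewrite n1 n2 n4 n5 n6.
Qed.

Lemma sum_kerA m b M : (m <= b <= M)%N ->
  \sum_(b.+1 <= q < M.+1) kerA m q
  = \sum_(0 <= p < m) kerB p b + u m / weight b - ker_err M m.
Proof.
case/andP=> mb bM; rewrite -(subnK bM) addnC.
elim: (M - b)%N => [|d IH]; first by rewrite addn0 big_geq // subrr.
rewrite addnS big_nat_recr //=; last by rewrite ltnS leq_addr.
have mbd : (m <= b + d)%N by apply: leq_trans mb (leq_addr _ _).
rewrite IH /ker_err -addrA; congr (_ + _).
have := sum_kerB_diff mbd; rewrite sumrB => /(canRL (subrK _)) ->.
have := kerA_diff mbd => /(canRL (addrK _)) ->; ring.
Qed.

Lemma kernel_ltn m b M : (m <= b <= M)%N ->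
  \sum_(0 <= q < M.+1 | (b < q)%N) kerA m q
  - \sum_(0 <= p < M.+1 | (p < m)%N) kerB p b
  = u m / weight b - ker_err M m.
Proof.
move=> mbM; have /andP[mb bM] := mbM.
rewrite -(big_nat_widenl b.+1 0 M.+1 xpredT) //.
rewrite -(big_nat_widen 0 m M.+1 xpredT) ?(leq_trans mb) ?leqW //.
by rewrite sum_kerA //; ring.
Qed.

(** Compared with the strict case there are two more terms, [kerA m b] and [kerB m b]; for $m<b$
    their difference is $-u_m/w_b$ and cancels the main term. *)
Lemma kernel_leq m b M : (m <= b <= M)%N ->
  \sum_(0 <= q < M.+1 | (b <= q)%N) kerA m q
  - \sum_(0 <= p < M.+1 | (p <= m)%N) kerB p b
  = (if m == b then (m%:R + a)^-1 else 0) - ker_err M m.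
Proof.
move=> mbM; have /andP[mb bM] := mbM.
rewrite -(big_nat_widenl b 0 M.+1 xpredT) //.
rewrite -(big_nat_widen 0 m.+1 M.+1 xpredT) ?ltnS ?(leq_trans mb) //.
rewrite big_ltn ?ltnS // sum_kerA // big_nat_recr //= /kerA /kerB /weight.
case: eqVneq => [<-|nmb].
  (* Here $m=b$: both extra terms are 0 by the convention on division, and $u_m/w_m=1/(m+a)$
     survives. *)
  by rewrite subrr !mulr0 !invr0 !mulr0; field; rewrite u_neq0 a_neq0.
have n1 : b%:R - m%:R != 0 :> F by apply: natrB_neq0; rewrite ltn_neqAle nmb.
by field; rewrite n1 u_neq0 a_neq0.
Qed.

End Kernel.

(** The source of the kernel: for [x = p + b] and [y = q + b] the denominator is $q-p$. Going from
    [K] to [K.+1] divides the old sum by [y] and adds one term. *)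
Lemma sum_geometric_inv {F : fieldType} (x y : F) K : x != 0 -> y != 0 -> x != y ->
  \sum_(0 <= j < K) (x ^+ j.+1)^-1 * (y ^+ (K - j))^-1
  = (x ^- K - y ^- K) / (y - x).
Proof.
move=> x0 y0 xy.
have yx : y - x != 0 by rewrite subr_eq0 eq_sym.
elim: K => [|K IH]; first by rewrite big_geq // !expr0 subrr mul0r.
rewrite big_nat_recr //= subSnn.
have -> : \sum_(0 <= j < K) (x ^+ j.+1)^-1 * (y ^+ (K.+1 - j))^-1
    = (\sum_(0 <= j < K) (x ^+ j.+1)^-1 * (y ^+ (K - j))^-1) / y.
  rewrite mulr_suml; apply: eq_big_nat => j /andP[_ jK].
  by rewrite subSn ?(ltnW jK) // [y ^+ _.+1]exprS invfM [y^-1 * _]mulrC mulrA.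
rewrite IH !exprS ?expr0.
by field; rewrite yx x0 y0 !expf_neq0.
Qed.

(** * Growth of [rise] against powers of harmonic sums *)

Section Growth.
Context {R : realType}.
Implicit Types (s : R) (m r N : nat).

(** As [harmonic l] is $1/(l+1)$, this is $(1+s)_m/m!$, which grows like $m^s$; the product form
    lets inequalities be checked factor by factor. *)
Definition rise s m : R := \prod_(0 <= l < m) (1 + s * harmonic l).

Lemma riseS s m : rise s m.+1 = rise s m * (1 + s * harmonic m).
Proof. by rewrite /rise big_nat_recr. Qed.

Lemma harmonic_le1 m : harmonic m <= 1 :> R.
Proof. by rewrite /= invf_le1 ?ltr0n // ler1n. Qed.

Lemma rise_ge1 s m : 0 <= s -> 1 <= rise s m.
Proof.
move=> s0; elim: m => [|m IH]; first by rewrite /rise big_geq.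
rewrite riseS; have := mulr_ge0 s0 (@harmonic_ge0 R m); nra.
Qed.

Lemma le_rise s s' m : 0 <= s -> s <= s' -> rise s m <= rise s' m.
Proof.
move=> s0 ss'; apply: ler_prod => l _.
rewrite addr_ge0 ?mulr_ge0 ?harmonic_ge0 //=.
by rewrite lerD2l ler_wpM2r // harmonic_ge0.
Qed.

Lemma rise_gt0 s m : 0 <= s -> 0 < rise s m.
Proof. by move=> s0; apply: lt_le_trans (rise_ge1 _ s0). Qed.

Lemma rise_le_nat s m : 0 <= s <= 1 -> rise s m <= m.+1%:R.
Proof.
case/andP=> s0 s1; elim: m => [|m IH]; first by rewrite /rise big_geq.
have hm : 0 < m.+1%:R :> R by rewrite ltr0n.
rewrite riseS (le_trans (ler_pM _ _ IH (_ : _ <= 1 + harmonic m))) //.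
- by rewrite ltW ?rise_gt0.
- by rewrite addr_ge0 ?mulr_ge0 ?harmonic_ge0.
- by rewrite lerD2l ler_piMl ?harmonic_ge0.
- by rewrite /= mulrDr mulr1 divff ?gt_eqF // natr1.
Qed.

(** Each step raises [rise s] by at least [s * harmonic m], because [rise s m] is at least 1. The
    last summand on the left is at most 1 and accounts for the 1 in the constant. *)
Lemma series_harmonic_le_rise s m : 0 < s ->
  series harmonic m.+1 <= (1 + s^-1) * rise s m.
Proof.
move=> s0.
have le m' : s * series harmonic m' <= rise s m'.
  elim: m' => [|m' IH]; first by rewrite /series /rise /= !big_geq // mulr0.
  rewrite seriesSr riseS; have := rise_ge1 m' (ltW s0).
  have := mulr_ge0 (ltW s0) (@harmonic_ge0 R m'); nra.
rewrite seriesSr mulrDl mul1r addrC lerD //.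
  by rewrite (le_trans (harmonic_le1 m)) // rise_ge1 // ltW.
by rewrite ler_pdivlMl.
Qed.

Lemma expr_rise s r m : 0 <= s <= 1 -> rise s m ^+ r <= rise (2 ^+ r * s) m.
Proof.
case/andP=> s0 s1; rewrite /rise -prodrXl; apply: ler_prod => l _.
set y := s * harmonic l.
have y0 : 0 <= y by rewrite mulr_ge0 ?harmonic_ge0.
have y1 : y <= 1 by rewrite (le_trans _ (harmonic_le1 l)) // ler_piMl ?harmonic_ge0.
rewrite exprn_ge0 ?addr_ge0 //= -mulrA -/y; clearbody y.
(* The chord of the convex function $(1+y)^r$ over $[0,1]$ has slope $2^r-1$. *)
suff: (1 + y) ^+ r <= 1 + (2 ^+ r - 1) * y by lra.
elim: r => [|r IH]; first by rewrite !expr0; lra.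
have : 1 <= 2 ^+ r :> R by rewrite exprn_ege1 // ler1n.
rewrite !exprS => t1.
apply: le_trans (ler_wpM2l (addr_ge0 ler01 y0) IH) _.
have : 0 <= (2 ^+ r - 1) * (y * (1 - y)) by rewrite !mulr_ge0 ?subr_ge0.
by rewrite -subr_ge0; congr (0 <= _); ring.
Qed.

Lemma series_harmonic_expr s r : 0 < s <= 1 ->
  exists2 C : R, 0 < C &
    forall m, series harmonic m.+1 ^+ r <= C * rise (s / 2) m.
Proof.
(* Chosen so that $2^r e=s/2$: by [expr_rise] the [r]-th power of [rise e] stays below
   [rise (s / 2)]. *)
case/andP=> s0 s1; pose e : R := s / 2 / 2 ^+ r.
have p0 : 0 < 2 ^+ r :> R by rewrite exprn_gt0.
have p1 : 1 <= 2 ^+ r :> R by rewrite exprn_ege1 // ler1n.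
have e0 : 0 < e by rewrite !divr_gt0.
have e1 : e <= 1 by rewrite /e ler_pdivrMr // mul1r; lra.
exists ((1 + e^-1) ^+ r) => [|m]; first by rewrite exprn_gt0 // addr_gt0 ?invr_gt0.
have -> : s / 2 = 2 ^+ r * e by rewrite /e [RHS]mulrC divfK // gt_eqF.
apply: (@le_trans _ _ ((1 + e^-1) ^+ r * rise e m ^+ r)).
  rewrite -exprMn lerXn2r ?nnegrE ?series_harmonic_le_rise //.
    by rewrite sumr_ge0 // => l _; rewrite harmonic_ge0.
  by rewrite mulr_ge0 ?ltW ?rise_gt0 ?ltW // addr_gt0 ?invr_gt0.
rewrite ler_wpM2l ?expr_rise ?(ltW e0) //.
by rewrite exprn_ge0 // ltW // addr_gt0 ?invr_gt0.
Qed.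

(** With $y_m$ the ratio and $h=1/(m+1)$, one has $y_m-y_{m+1}=y_m(sh/2)/(1+sh)\ge(s/4)hy_m$ because
    $sh\le1$; so the sum is dominated by a telescoping one. *)
Lemma sum_rise_ratio s N : 0 < s <= 1 ->
  \sum_(0 <= m < N) harmonic m * (rise (s / 2) m / rise s m) <= 4 / s.
Proof.
case/andP=> s0 s1.
have s20 : 0 <= s / 2 by rewrite divr_ge0 // ltW.
pose y m := rise (s / 2) m / rise s m.
have y0 m : 0 < y m by rewrite divr_gt0 ?rise_gt0 // ltW.
suff: \sum_(0 <= m < N) harmonic m * y m <= 4 / s * (1 - y N).
  move=> /le_trans; apply; rewrite ler_piMr ?divr_ge0 ?(ltW s0) //.
  by rewrite gerBl ltW.
elim: N => [|N IH].
  by rewrite big_geq // /y /rise !big_geq // divr1 subrr mulr0.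
rewrite big_nat_recr //=; apply: le_trans (lerD IH (lexx _)) _.
have -> : y N.+1 = y N * (1 + s / 2 * harmonic N) / (1 + s * harmonic N).
  by rewrite /y !riseS invfM; ring.
set x := harmonic N.
have x0 : 0 <= x := @harmonic_ge0 R N; have x1 : x <= 1 := harmonic_le1 N.
have d0 : 0 < 1 + s * x by nra.
rewrite -subr_ge0; have := y0 N; set z := y N => z0.
have -> : 4 / s * (1 - z * (1 + s / 2 * x) / (1 + s * x))
    - (4 / s * (1 - z) + N.+1%:R^-1 * z)
  = z * x * (1 - s * x) / (1 + s * x).
  by rewrite -[N.+1%:R^-1]/x; field; rewrite !gt_eqF.
have sx : 0 <= 1 - s * x by nra.
by rewrite divr_ge0 ?(ltW d0) // mulr_ge0 // mulr_ge0 // ltW.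
Qed.

Lemma sum_harmonic_expr_rise s r : 0 < s <= 1 ->
  exists C : R, forall N,
    \sum_(0 <= m < N) harmonic m * (series harmonic m.+1 ^+ r / rise s m) <= C.
Proof.
move=> s01; have [C C0 hC] := series_harmonic_expr r s01.
have /andP[s0 s1] := s01.
exists (C * (4 / s)) => N.
apply: le_trans (ler_wpM2l (ltW C0) (sum_rise_ratio N s01)).
rewrite mulr_sumr; apply: ler_sum => m _.
rewrite [leRHS]mulrCA; apply: ler_wpM2l; first exact: harmonic_ge0.
by rewrite mulrA ler_wpM2r // invr_ge0 ltW ?rise_gt0 // ltW.
Qed.

Lemma series_harmonic_gt0 m : 0 < series harmonic m.+1 :> R.
Proof.
rewrite seriesSr ltr_wpDl ?harmonic_gt0 //.
by rewrite sumr_ge0 // => l _; rewrite harmonic_ge0.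
Qed.

Lemma cvg_series_harmonic_inv :
  ((series harmonic m.+1)^-1 @[m --> \oo] --> (0 : R))%classic.
Proof.
have H0 := series_harmonic_gt0.
apply/gtr0_cvgV0; first exact: nearW.
rewrite (@cvg_shiftS R (series harmonic)).
apply: nondecreasing_dvgn_lt; last exact: dvg_harmonic.
by apply: nondecreasing_series => l _ _; rewrite harmonic_ge0.
Qed.

(** Already the power [r.+1] is bounded by a multiple of [rise], so the quotient is at most a
    constant divided by the harmonic sum, which diverges. *)
Lemma cvg_harmonic_expr_rise s r : 0 < s <= 1 ->
  (series harmonic m.+1 ^+ r / rise s m @[m --> \oo] --> (0 : R))%classic.
Proof.
move=> s01; have [C C0 hC] := series_harmonic_expr r.+1 s01.
have /andP[s0 s1] := s01.
have H0 := series_harmonic_gt0.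
apply: (@squeeze_cvgr _ _ _ _ (fun=> 0) (fun m => C * (series harmonic m.+1)^-1)).
- apply: nearW => m; apply/andP; split.
    by rewrite divr_ge0 ?exprn_ge0 // ltW ?rise_gt0 // ltW.
  cbv beta; rewrite ler_pdivrMr ?rise_gt0 ?(ltW s0) // [leRHS]mulrAC ler_pdivlMr // -exprSr.
  apply: le_trans (hC m) _; rewrite ler_wpM2l ?(ltW C0) //.
  by rewrite le_rise ?divr_ge0 ?(ltW s0) //; lra.
- exact: cvg_cst.
- rewrite -[X in (_ --> X)%classic](mulr0 C); apply: cvgM; first exact: cvg_cst.
  exact: cvg_series_harmonic_inv.
Qed.

End Growth.

(** * Convergence of complex sequences *)

Section ComplexLimits.
Local Open Scope classical_set_scope.
Context {R : realType}.

Lemma Re_le_norm (z : R[i]) : (complex.Re z)%:C <= `|z|.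
Proof.
case: z => x y; rewrite normc_def lecR /=.
by rewrite (le_trans (ler_norm _)) // -sqrtr_sqr ler_wsqrtr // lerDl sqr_ge0.
Qed.

Lemma Im_le_norm (z : R[i]) : (complex.Im z)%:C <= `|z|.
Proof.
case: z => x y; rewrite normc_def lecR /=.
by rewrite (le_trans (ler_norm _)) // -sqrtr_sqr ler_wsqrtr // lerDr sqr_ge0.
Qed.

Lemma cvg_real_complex (x : nat -> R) (l : R) : x @ \oo --> l ->
  (fun n => (x n)%:C : R[i]^o) @ \oo --> (l%:C : R[i]^o).
Proof.
move=> /cvgrPdist_lt xl; apply/cvgrPdist_lt => e; case: e => e e'.
(* The radius lives in [R[i]]; its positivity there includes that it is real. *)
rewrite ltcE /= => /andP[/eqP -> e0]; near=> n.
rewrite -raddfB normc_def /= expr0n addr0 sqrtr_sqr ltcR.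
by near: n; apply: xl.
Unshelve. all: by end_near. Qed.

Lemma cvg0_norm_le (u : nat -> R[i]) (x : nat -> R) :
    (forall n, `|u n| <= (x n)%:C) -> x @ \oo --> (0 : R) ->
  (u : nat -> R[i]^o) @ \oo --> (0 : R[i]^o).
Proof.
move=> ux /cvg_real_complex /cvgrPdist_lt x0; apply/cvgrPdist_lt => e e0.
near=> n; rewrite sub0r normrN (le_lt_trans (ux n)) //.
suff: `|0%:C - (x n)%:C| < e.
  by rewrite sub0r normrN; apply: le_lt_trans; rewrite real_ler_norm // complex_real.
by near: n; apply: x0.
Unshelve. all: by end_near. Qed.

(* [S - f] is monotone and bounded, hence converges together with [S]. *)
Lemma is_cvg_dominated (f S : nat -> R) (B : R) :
    (forall M N, (M <= N)%N -> `|f N - f M| <= S N - S M) ->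
    (forall N, S N <= B) ->
  cvgn f.
Proof.
move=> fS SB.
have ndS : nondecreasing_seq S.
  by move=> M N MN; rewrite -subr_ge0 (le_trans (normr_ge0 _) (fS _ _ MN)).
have cS : cvgn S.
  by apply: nondecreasing_is_cvgn => //; exists B => _ [N _ <-]; apply: SB.
have cSf : cvgn (S \- f).
  apply: nondecreasing_is_cvgn.
    move=> M N MN; rewrite /= -subr_ge0.
    by have := fS _ _ MN; rewrite ler_norml => /andP[_]; lra.
  exists (2 * B - S 0%N - f 0%N) => _ [N _ <-] /=.
  have := fS 0%N N isT; rewrite ler_norml => /andP[+ _].
  have := SB N; lra.
suff -> : f = S \- (S \- f) by apply: is_cvgB.
by apply/funext => N /=; rewrite subKr.
Qed.

Lemma is_cvg_complex_dominated (u : nat -> R[i]) (S : nat -> R) (B : R) :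
    (forall M N, (M <= N)%N -> `|u N - u M| <= (S N - S M)%:C) ->
    (forall N, S N <= B) ->
  cvgn (u : nat -> R[i]^o).
Proof.
move=> uS SB.
have cRe : cvgn (fun n => complex.Re (u n)).
  apply: (is_cvg_dominated _ SB) => M N MN; rewrite ler_norml.
  (* [Re_le_norm] is one-sided, so it is used for [u N - u M] and for [u M - u N]. *)
  have := le_trans (Re_le_norm _) (uS _ _ MN).
  have := Re_le_norm (u M - u N); rewrite -normrN opprB => /le_trans/(_ (uS _ _ MN)).
  by case: (u M) (u N) => [a b] [c d] /=; rewrite !lecR; lra.
have cIm : cvgn (fun n => complex.Im (u n)).
  apply: (is_cvg_dominated _ SB) => M N MN; rewrite ler_norml.
  have := le_trans (Im_le_norm _) (uS _ _ MN).
  have := Im_le_norm (u M - u N); rewrite -normrN opprB => /le_trans/(_ (uS _ _ MN)).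
  by case: (u M) (u N) => [a b] [c d] /=; rewrite !lecR; lra.
have -> : (u : nat -> R[i]^o) = (fun n => ((complex.Re (u n))%:C : R[i]^o)
     + ('i : R[i]) *: ((complex.Im (u n))%:C : R[i]^o)).
  by apply/funext => n; exact: complexE.
apply: cvgP; apply: cvgD; first exact: cvg_real_complex cRe.
by apply: cvgZl_tmp; exact: cvg_real_complex cIm.
Qed.

End ComplexLimits.

(** * The exact identity for truncated sums *)

Section FiniteIdentity.
Context {R : realType} (a b : R[i]).
Hypothesis a_neq0 : forall m : nat, m%:R + a != 0.
Hypothesis b_neq0 : forall m : nat, m%:R + b != 0.
Implicit Types (ks ms l : seq nat) (m p q : nat) (e : rel nat).

Definition coeff m : R[i] := poch a m / m`!%:R.

Definition fac k m : R[i] := 1 / ((m%:R + a) * (m%:R + b) ^+ (k - 1)).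

Definition facs ks ms : R[i] :=
  \prod_(0 <= i < size ks) fac (nth 0%N ks i) (nth 0%N ms i).

Let u := coeff.
Let w := weight u a.
Let A := kerA u a.
Let B := kerB u.

Lemma coeffS m : coeff m.+1 * m.+1%:R = coeff m * (m%:R + a).
Proof.
have n1 : m.+1%:R != 0 :> R[i] by rewrite pnatr_eq0.
have n2 : m`!%:R != 0 :> R[i] by rewrite pnatr_eq0 -lt0n fact_gt0.
rewrite /coeff /poch big_ord_recr /= factS natrM invfM.
rewrite [m%:R + a]addrC -!mulrA; congr (_ * _).
by rewrite [_^-1 * m.+1%:R]mulrC mulKf // mulrC.
Qed.

Lemma coeff_neq0 m : coeff m != 0.
Proof.
rewrite mulf_neq0 ?invr_eq0 ?pnatr_eq0 -?lt0n ?fact_gt0 //.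
by apply/prodf_neq0 => l _; rewrite addrC.
Qed.

Lemma facs_cons k ks m ms : facs (k :: ks) (m :: ms) = fac k m * facs ks ms.
Proof. by rewrite /facs /= big_nat_recl. Qed.

Lemma facs_rcons k ks m ms : size ks = size ms ->
  facs (rcons ks k) (rcons ms m) = facs ks ms * fac k m.
Proof.
move=> sz; rewrite /facs size_rcons big_nat_recr //=.
rewrite !nth_rcons ltnn -sz ltnn eqxx; congr (_ * _).
by apply: eq_big_nat => i /andP[_ ik]; rewrite !nth_rcons ik -sz ik.
Qed.

Lemma ratio_factorE ms :
  ratio_factor a ms = coeff (head 0%N ms) / coeff (last 0%N ms).
Proof. by rewrite /ratio_factor /coeff invf_div. Qed.

Lemma termIE k ks k' p ms q : size ks = size ms ->
  termI a b (k :: rcons ks k') (p :: rcons ms q)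
  = coeff p / coeff q * (1 / (p%:R + b) ^+ k) * (facs ks ms * fac k' q).
Proof.
move=> sz; rewrite /termI ratio_factorE -facs_rcons // /= last_rcons.
by rewrite /facs big_add1.
Qed.

(** The last index [k.+1] leaves the exponent [k - 1] on $q+b$, so the last factor is [fac k q]
    divided by one further $q+a$, which turns $u_q$ into $w_q$. *)
Lemma termIIE k ks m ms q : size ks = size ms -> m = head 0%N (rcons ms q) ->
  termII a b (rcons ks k.+1) (rcons ms q)
  = coeff m / w q * facs (rcons ks k) (rcons ms q).
Proof.
move=> sz ->; rewrite /termII ratio_factorE facs_rcons // last_rcons size_rcons /=.
rewrite !nth_rcons -sz ltnn eqxx subSS (_ : \prod_(0 <= i < _) _ = facs ks ms).
  by rewrite /w /weight -/(u q) /fac !div1r expr2; move: (u q) => v; rewrite !invfM; ring.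
by apply: eq_big_nat => i /andP[_ ik]; rewrite !nth_rcons ik -sz ik.
Qed.

(** The geometric sum splits into a part with $(p+b)^{-(k-1)}$, where $q$ enters only through the
    kernel, and one with $(q+b)^{-(k-1)}$, where $p$ does; accordingly [k] is placed before or after
    [l]. For $p=q$ the kernels are 0 and the $k-1$ terms are all equal. *)
Lemma sum_termI k l p ms q : (0 < k)%N -> size l = size ms ->
  \sum_(0 <= j < k.-1) termI a b (j.+1 :: rcons l (k - j)%N) (p :: rcons ms q)
  = A p q * facs (k :: l) (p :: ms) - B p q * facs (rcons l k) (rcons ms q)
    + (if p == q then k.-1%:R * facs (rcons l k.+1) (rcons ms q) else 0).
Proof.
case: k => [//|k] _ sz /=.
have -> : \sum_(0 <= j < k) termI a b (j.+1 :: rcons l (k.+1 - j)%N) (p :: rcons ms q)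
    = u p / u q * facs l ms / (q%:R + a)
      * \sum_(0 <= j < k) ((p%:R + b) ^+ j.+1)^-1 * ((q%:R + b) ^+ (k - j))^-1.
  rewrite mulr_sumr; apply: eq_big_nat => j /andP[_ jk].
  rewrite termIE // /fac (_ : k.+1 - j - 1 = k - j)%N; last by lia.
  by rewrite !div1r (invfM (q%:R + a)) /u; ring.
rewrite !facs_cons !facs_rcons // /A /B /kerA /kerB /weight.
have u0 := coeff_neq0 q; have q0 := a_neq0 q; have p0 := a_neq0 p.
have qb0 := b_neq0 q; have pb0 := b_neq0 p.
case: eqVneq => [<-|pq].
  rewrite subrr !mulr0 !invr0 !mulr0 !mul0r subrr add0r.
  rewrite divff ?coeff_neq0 // mul1r /fac subSS subn0.
  rewrite (eq_big_nat _ _ (F2 := fun=> (p%:R + b) ^- k.+1)).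
    by rewrite sumr_const_nat subn0 div1r (invfM (p%:R + a)) -mulr_natl; ring.
  by move=> j /andP[_ jk]; rewrite -invfM -exprD; congr (_ ^- _); lia.
have pq0 : q%:R - p%:R != 0 :> R[i] by rewrite subr_eq0 eqr_nat eq_sym.
rewrite sum_geometric_inv //; last first.
  by rewrite (inj_eq (addIr _)) eqr_nat.
rewrite (_ : q%:R + b - (p%:R + b) = q%:R - p%:R); last by ring.
rewrite /fac !subSS !subn0 addr0 /u.
field.
by rewrite u0 q0 p0 pq0 !expf_neq0.
Qed.

Definition chain_psum e r N (F : seq nat -> R[i]) : R[i] :=
  list_sum r N (fun ms => if sorted e ms then F ms else 0).

Lemma chain_psum_sum (I : Type) (s : seq I) e r N (F : I -> seq nat -> R[i]) :
  \sum_(i <- s) chain_psum e r N (F i)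
  = chain_psum e r N (fun ms => \sum_(i <- s) F i ms).
Proof.
rewrite /chain_psum -list_sum_sum; apply: eq_list_sum => ms _ _.
by case: ifP => // _; rewrite big1.
Qed.

Lemma chain_psumD e r N F G :
  chain_psum e r N (fun ms => F ms + G ms)
  = chain_psum e r N F + chain_psum e r N G.
Proof.
rewrite /chain_psum -list_sumD; apply: eq_list_sum => ms _ _.
by case: ifP => // _; rewrite addr0.
Qed.

Lemma chain_psumB e r N F G :
  chain_psum e r N (fun ms => F ms - G ms)
  = chain_psum e r N F - chain_psum e r N G.
Proof.
rewrite /chain_psum -list_sumB; apply: eq_list_sum => ms _ _.
by case: ifP => // _; rewrite subr0.
Qed.

Lemma eq_chain_psum e r N F G :
    (forall ms, size ms = r -> sorted e ms -> all (gtn N) ms -> F ms = G ms) ->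
  chain_psum e r N F = chain_psum e r N G.
Proof.
move=> FG; apply: eq_list_sum => ms rms Nms.
by case: ifP => // ms_e; apply: FG.
Qed.

(** The chain condition ties the first variable to the second alone, so it can be summed out for
    fixed values of the others. *)
Lemma chain_psum_behead e r N (K : nat -> nat -> R[i]) (G : seq nat -> R[i]) :
  chain_psum e r.+2 N (fun ms => K (head 0%N ms) (last 0%N ms) * G (behead ms))
  = chain_psum e r.+1 N (fun ms =>
      G ms * \sum_(0 <= p < N | e p (head 0%N ms)) K p (last 0%N ms)).
Proof.
rewrite /chain_psum list_sum_cons; apply: eq_list_sum => -[//|m ms] _ _ /=.
case: ifP => /= ms_e; last by rewrite big1 // => p _; rewrite andbF.
under eq_bigr do rewrite andbT.
by rewrite -big_mkcond mulr_sumr; apply: eq_bigr => p _; rewrite mulrC.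
Qed.

Lemma chain_psum_belast e r N (K : nat -> nat -> R[i]) (G : seq nat -> R[i]) :
  chain_psum e r.+2 N (fun ms => K (head 0%N ms) (last 0%N ms) * G (take r.+1 ms))
  = chain_psum e r.+1 N (fun ms =>
      G ms * \sum_(0 <= q < N | e (last 0%N ms) q) K (head 0%N ms) q).
Proof.
rewrite /chain_psum list_sum_rcons; apply: eq_list_sum => -[//|m ms] [rms] _.
under eq_bigr do rewrite last_rcons -cats1 (@take_size_cat _ r.+1 (m :: ms)) /= ?rms //.
under eq_bigr do rewrite cats1 rcons_path.
case: ifP => /= ms_e; last by rewrite ms_e big1.
under eq_bigr do rewrite ms_e.
by rewrite -big_mkcond mulr_sumr; apply: eq_bigr => p _; rewrite mulrC.
Qed.

(** Together with [rotS_cyc_others] this reads the lists [k :: l] and [rcons l k] of [sum_termI] as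
    consecutive rotations of one index. *)
Lemma rot_cyc_others ks i : (i < size ks)%N ->
  rot i ks = nth 0%N ks i :: cyc_others ks i.
Proof. by move=> ik; rewrite /rot (drop_nth 0%N). Qed.

Lemma rotS_cyc_others ks i : (i < size ks)%N ->
  rot i.+1 ks = rcons (cyc_others ks i) (nth 0%N ks i).
Proof. by move=> ik; rewrite /rot (take_nth 0%N) // -rcons_cat. Qed.

Lemma size_cyc_others ks i : (i < size ks)%N -> size (cyc_others ks i) = (size ks).-1.
Proof.
by move=> ik; rewrite -(size_rot i ks) rot_cyc_others.
Qed.

(** Rotation by [size ks] is the identity, so the shift only permutes the terms. This is how the
    cyclic summation enters. *)
Lemma sum_rotS ks (X : seq nat -> R[i]) :
  \sum_(0 <= i < size ks) X (rot i.+1 ks) = \sum_(0 <= i < size ks) X (rot i ks).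
Proof.
case E : (size ks) => [|n]; first by rewrite !big_geq.
by rewrite big_nat_recr //= -E rot_size E big_nat_recl // rot0 addrC.
Qed.

(** The relation [e] and the function [diag] are left open to cover both identities: [kernel_ltn]
    and [kernel_leq] supply the second hypothesis. *)
Lemma cyclic_sum_finite e (diag : nat -> nat -> R[i]) M ks :
    (forall x y, e x y -> (x <= y)%N) ->
    (forall m c, (m <= c <= M)%N ->
       \sum_(0 <= q < M.+1 | e c q) A m q - \sum_(0 <= p < M.+1 | e p m) B p c
       = diag m c - ker_err u a M m) ->
    (0 < size ks)%N -> all (leq 1) ks ->
  \sum_(0 <= i < size ks) \sum_(0 <= j < (nth 0%N ks i).-1)
    chain_psum e (size ks).+1 M.+1
      (termI a b (j.+1 :: rcons (cyc_others ks i) (nth 0%N ks i - j)%N))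
  = \sum_(0 <= i < size ks) chain_psum e (size ks) M.+1
      (fun ms => facs (rot i ks) ms * diag (head 0%N ms) (last 0%N ms))
    - \sum_(0 <= i < size ks) chain_psum e (size ks) M.+1
      (fun ms => facs (rot i ks) ms * ker_err u a M (head 0%N ms))
    + \sum_(0 <= i < size ks) chain_psum e (size ks).+1 M.+1
      (fun ms => if head 0%N ms == last 0%N ms
        then (nth 0%N ks i).-1%:R
             * facs (rcons (cyc_others ks i) (nth 0%N ks i).+1) (behead ms)
        else 0).
Proof.
move=> e_leq kernel; case E : (size ks) => [//|r] _ ks_ge1.
pose SA l := chain_psum e r.+2 M.+1 (fun ms =>
  A (head 0%N ms) (last 0%N ms) * facs l (take r.+1 ms)).
pose SB l := chain_psum e r.+2 M.+1 (fun ms =>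
  B (head 0%N ms) (last 0%N ms) * facs l (behead ms)).
transitivity (\sum_(0 <= i < size ks) (SA (rot i ks) - SB (rot i.+1 ks))
    + \sum_(0 <= i < size ks) chain_psum e r.+2 M.+1
      (fun ms => if head 0%N ms == last 0%N ms
        then (nth 0%N ks i).-1%:R
             * facs (rcons (cyc_others ks i) (nth 0%N ks i).+1) (behead ms)
        else 0)).
  rewrite -big_split /= E; apply: eq_big_nat => i /andP[_ ir].
  have ik : (i < size ks)%N by rewrite E.
  rewrite /SA /SB -chain_psumB -chain_psumD chain_psum_sum.
  apply: eq_chain_psum => -[//|p ms] [rms] ms_e _.
  case/lastP: ms rms ms_e => [//|ms q] rms ms_e.
  rewrite sum_termI.
  - rewrite rot_cyc_others // rotS_cyc_others // /= last_rcons.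
    move: rms; rewrite size_rcons => -[rms].
    by rewrite (_ : take r (rcons ms q) = ms) // -cats1 take_size_cat.
  - by move/all_nthP: ks_ge1; apply.
  - by move: rms; rewrite size_rcons size_cyc_others // E => -[].
rewrite E; congr (_ + _); rewrite sumrB -E (sum_rotS ks SB) -!sumrB.
(* Summing out $q$ in [SA] and $p$ in [SB] leaves chains of length [size ks] with one common weight,
   to which [kernel] applies. *)
apply: eq_bigr => i _; rewrite /SA /SB (chain_psum_belast e r M.+1 A).
rewrite (chain_psum_behead e r M.+1 B) E -!chain_psumB.
apply: eq_chain_psum => -[//|m ms] _ ms_e ms_lt.
rewrite -!mulrBr kernel //=.
have ms_leq : path leq m ms by apply: sub_path ms_e.
apply/andP; split; last first.
  by move/allP: ms_lt => /(_ (last m ms) (mem_last _ _)).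
case: ms ms_leq {ms_e ms_lt} => [//|x ms] ms_leq.
by have /allP/(_ _ (mem_last x ms)) := order_path_min leq_trans ms_leq.
Qed.

Lemma facs_nseq l m :
  facs l (nseq (size l) m)
  = 1 / ((m%:R + a) ^+ size l * (m%:R + b) ^+ (\sum_(k <- l) (k - 1))).
Proof.
elim: l => [|k l IH]; first by rewrite /facs !big_nil !expr0 mulr1 divr1.
rewrite facs_cons IH big_cons /= exprS exprD /fac !div1r -invfM.
by congr (_^-1); ring.
Qed.

End FiniteIdentity.

(** * Bounds, convergence and the vanishing of the error *)

Section Estimates.
Local Open Scope classical_set_scope.
Context {R : realType}.
Implicit Types (ks ms l : seq nat) (m p q : nat).

Lemma Re_normK (z : R[i]) : (complex.Re `|z|)%:C = `|z|.
Proof. by rewrite RRe_real // normr_real. Qed.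

Lemma norm_natc m : `|m%:R : R[i]| = (m%:R)%:C.
Proof. by rewrite normr_nat rmorph_nat. Qed.

Lemma norm_inv_natD_le (c : R[i]) : (forall m : nat, m%:R + c != 0) ->
  exists2 D : R, 1 <= D &
    forall m, `|(m%:R + c)^-1| <= (D * harmonic m)%:C.
Proof.
move=> c0; pose B := complex.Re `|c|.
have B0 : 0 <= B by rewrite -lecR Re_normK normr_ge0.
pose x m : R := complex.Re `|(m%:R + c)^-1|.
have x0 m : 0 <= x m by rewrite -lecR Re_normK normr_ge0.
pose M := (Num.truncn (2 * B + 1)).+1.
have MB : 2 * B + 1 < M%:R by apply: truncnS_gt.
(* For [m >= M] one has $|m+c|\ge m-|c|\ge(m+1)/2$, which accounts for the 2; the sum takes care of
   the finitely many smaller [m]. *)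
exists (2 + \sum_(0 <= l < M) x l * l.+1%:R).
  have : 0 <= \sum_(0 <= l < M) x l * l.+1%:R :> R.
    by apply: sumr_ge0 => l _; rewrite mulr_ge0.
  lra.
move=> m; rewrite -Re_normK lecR -/(x m) ler_pdivlMr ?ltr0n //.
have S0 : 0 <= \sum_(0 <= l < M) x l * l.+1%:R :> R.
  by apply: sumr_ge0 => l _; rewrite mulr_ge0.
case: (ltnP m M) => mM.
  rewrite (bigD1_seq m) ?iota_uniq ?mem_index_iota //=.
  rewrite addrCA lerDl addr_ge0 //; apply: sumr_ge0 => l _.
  by rewrite mulr_ge0.
suff : x m * m.+1%:R <= 2 by lra.
have mB : 2 * B + 1 <= m%:R by rewrite (le_trans (ltW MB)) // ler_nat.
have mBc : (m%:R - B)%:C <= `|m%:R + c|.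
  rewrite rmorphB /= Re_normK -norm_natc -[c in leRHS]opprK.
  by rewrite -[`|c|]normrN lerB_dist.
have mB0 : 0 < m%:R - B by lra.
have : x m <= (m%:R - B)^-1.
  rewrite -lecR Re_normK normfV fmorphV lef_pV2 ?posrE ?normr_gt0 //.
  by rewrite ltcR.
move=> /(ler_wpM2r (ler0n R m.+1)) /le_trans; apply.
by rewrite mulrC ler_pdivrMr // -natr1; lra.
Qed.

Context (a b : R[i]).
Hypothesis a_gt0 : 0 < complex.Re a.
Hypothesis b_notin : forall m : nat, b <> - m%:R.

(** At most $\mathrm{Re}(a)$ to have $|m+a|\ge m+s$, and at most 1 for growth estimates such as
    [rise_le_nat]. *)
Let s : R := Num.min (complex.Re a) 1.

Lemma step_bounds : 0 < s <= 1.
Proof. by rewrite /s lt_min a_gt0 ltr01 /= ge_min lexx orbT. Qed.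

Let s_gt0 : 0 < s. Proof. by case/andP: step_bounds. Qed.
Let s_le1 : s <= 1. Proof. by case/andP: step_bounds. Qed.

Lemma norm_natDa m : (m%:R + s)%:C <= `|m%:R + a|.
Proof.
apply: le_trans (Re_le_norm _); rewrite lecR.
have -> : complex.Re (m%:R + a) = m%:R + complex.Re a.
  by rewrite -[m%:R in LHS](rmorph_nat (real_complex R)); case: (a).
by rewrite lerD2l ge_min lexx.
Qed.

Lemma natDa_neq0 m : m%:R + a != 0.
Proof.
rewrite -normr_gt0; apply: lt_le_trans (norm_natDa m).
by rewrite ltcR ltr_wpDl.
Qed.

Lemma natDb_neq0 m : m%:R + b != 0.
Proof. by rewrite addrC addr_eq0; apply/eqP/b_notin. Qed.

Lemma inv_bounds : exists2 D : R, 1 <= D & forall m,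
  `|(m%:R + a)^-1| <= (D * harmonic m)%:C /\ `|(m%:R + b)^-1| <= (D * harmonic m)%:C.
Proof.
have [Da Da1 aD] := norm_inv_natD_le natDa_neq0.
have [Db Db1 bD] := norm_inv_natD_le natDb_neq0.
exists (Da + Db) => [|m]; first by lra.
split; [apply: le_trans (aD m) _ | apply: le_trans (bD m) _];
  rewrite lecR ler_wpM2r ?harmonic_ge0 //; lra.
Qed.

Section WithBound.
Variable D : R.
Hypothesis D_ge1 : 1 <= D.
Hypothesis boundD : forall m,
  `|(m%:R + a)^-1| <= (D * harmonic m)%:C /\ `|(m%:R + b)^-1| <= (D * harmonic m)%:C.

Let D_gt0 : 0 < D. Proof. exact: lt_le_trans D_ge1. Qed.

Lemma norm_invbX k m : `|((m%:R + b) ^+ k)^-1| <= ((D * harmonic m) ^+ k)%:C.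
Proof.
rewrite -exprVn normrX rmorphXn /= lerXn2r ?nnegrE ?normr_ge0 //.
  by rewrite ler0c mulr_ge0 ?harmonic_ge0 // ltW.
by case: (boundD m).
Qed.

Lemma norm_fac k m : (0 < k)%N -> `|fac a b k m| <= ((D * harmonic m) ^+ k)%:C.
Proof.
case: k => [//|k] _; rewrite /fac div1r invfM normrM exprS rmorphM /= subSS subn0.
by rewrite ler_pM ?normr_ge0 ?norm_invbX //; case: (boundD m).
Qed.

Lemma bound_expr k m : (0 < k)%N ->
  (D * harmonic m) ^+ k <= D ^+ k * harmonic m.
Proof.
case: k => [//|k] _; rewrite exprMn ler_wpM2l ?exprn_ge0 ?(ltW D_gt0) //.
by rewrite exprS ler_piMr ?harmonic_ge0 // exprn_ile1 ?harmonic_ge0 ?harmonic_le1.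
Qed.

(** Two of the [k] harmonic factors are kept, one of them enlarged to [harmonic x]; the others are
    at most 1. *)
Lemma bound_expr2 k m x : (1 < k)%N -> (x <= m)%N ->
  (D * harmonic m) ^+ k <= D ^+ k * harmonic m * harmonic x.
Proof.
case: k => [//|k] k0 xm; rewrite exprS.
apply: le_trans (ler_wpM2l _ (bound_expr m k0)) _.
  by rewrite mulr_ge0 ?harmonic_ge0 // ltW.
rewrite [leRHS](_ : _ = D * harmonic m * (D ^+ k * harmonic x)); last by rewrite exprS; ring.
rewrite ler_wpM2l ?mulr_ge0 ?harmonic_ge0 ?(ltW D_gt0) //.
rewrite ler_wpM2l ?exprn_ge0 ?(ltW D_gt0) //=.
by rewrite lef_pV2 ?posrE ?ltr0n // ler_nat.
Qed.

Lemma prod_harmonic_ge0 ms : 0 <= \prod_(m <- ms) harmonic m :> R.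
Proof. by apply: prodr_ge0 => m _; rewrite harmonic_ge0. Qed.

Lemma norm_facs ks ms : size ks = size ms -> all (leq 1) ks ->
  `|facs a b ks ms| <= (D ^+ sumn ks * \prod_(m <- ms) harmonic m)%:C.
Proof.
elim: ks ms => [|k ks IH] [|m ms] //.
  by rewrite /facs !big_nil normr1 expr0 mulr1.
move=> [sz] /andP[k0 ks0]; rewrite facs_cons normrM big_cons [sumn _]/=.
apply: le_trans (ler_pM (normr_ge0 _) (normr_ge0 _) (norm_fac m k0) (IH _ sz ks0)) _.
rewrite -rmorphM lecR exprD.
apply: le_trans (ler_wpM2r _ (bound_expr m k0)) _.
  by rewrite mulr_ge0 ?prod_harmonic_ge0 // exprn_ge0 // ltW.
by rewrite le_eqVlt; apply/orP; left; apply/eqP; ring.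
Qed.

(** An entry at least 2 yields, by [bound_expr2], one harmonic factor more than in [norm_facs].
    Taken at the smallest variable, it is the factor that [norm_ker_err] consumes. *)
Lemma norm_facs2 x ks ms : size ks = size ms -> all (leq 1) ks ->
    has (leq 2) ks -> all (leq x) ms ->
  `|facs a b ks ms|
    <= (D ^+ sumn ks * \prod_(m <- ms) harmonic m * harmonic x)%:C.
Proof.
elim: ks ms => [|k ks IH] [|m ms] // [sz] /andP[k0 ks0] k2 /andP[xm xms].
rewrite facs_cons normrM big_cons [sumn _]/=.
have [k1|k1] := leqP 2 k.
  apply: le_trans (ler_pM (normr_ge0 _) (normr_ge0 _) (norm_fac m k0)
    (norm_facs sz ks0)) _.
  rewrite -rmorphM lecR exprD.
  apply: le_trans (ler_wpM2r _ (bound_expr2 k1 xm)) _.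
    by rewrite mulr_ge0 ?prod_harmonic_ge0 // exprn_ge0 // ltW.
  by rewrite le_eqVlt; apply/orP; left; apply/eqP; ring.
move: k2; rewrite [has _ _]/= leqNgt k1 => k2.
apply: le_trans (ler_pM (normr_ge0 _) (normr_ge0 _) (norm_fac m k0)
  (IH _ sz ks0 k2 xms)) _.
rewrite -rmorphM lecR exprD.
apply: le_trans (ler_wpM2r _ (bound_expr m k0)) _.
  by rewrite !mulr_ge0 ?prod_harmonic_ge0 ?harmonic_ge0 // exprn_ge0 // ltW.
by rewrite le_eqVlt; apply/orP; left; apply/eqP; ring.
Qed.

End WithBound.

(** For $q=p$ use $s(p+1)\le p+s\le|p+a|$ and [rise_le_nat]. Each further step multiplies $w_m$ by
    $(m+1+a)/(m+1)$, whose modulus is at least $1+s/(m+1)$, the next factor of [rise]. *)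
Lemma norm_weight p q : (p <= q)%N ->
  (s * rise s q)%:C * `|coeff a p| <= `|weight (coeff a) a q|.
Proof.
move=> pq; rewrite -(subnK pq); elim: (q - p)%N => [|d IH].
  rewrite add0n /weight (normrM (coeff a p)) [leLHS]mulrC ler_wpM2l ?normr_ge0 //.
  apply: le_trans (norm_natDa p); rewrite lecR.
  have := @rise_le_nat R s p; rewrite (ltW s_gt0) s_le1 => /(_ isT).
  rewrite -natr1 => /(ler_wpM2l (ltW s_gt0)) /le_trans; apply.
  by rewrite mulrDr mulr1 lerD2r ler_piMl.
rewrite addSn; set m := (d + p)%N in IH *.
have -> : weight (coeff a) a m.+1
    = weight (coeff a) a m * ((m.+1%:R + a) / m.+1%:R).
  by rewrite /weight (uSE (coeffS a)) mulrAC -!mulrA.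
rewrite (normrM (weight _ _ m)) riseS mulrA rmorphM /= mulrAC.
apply: ler_pM IH _; rewrite ?mulr_ge0 ?normr_ge0 //.
- by rewrite ler0c mulr_ge0 ?ltW ?rise_gt0 // ltW.
- by rewrite ler0c addr_ge0 ?mulr_ge0 ?harmonic_ge0 // ltW.
rewrite normf_div norm_natc ler_pdivlMr; last by rewrite ltcR ltr0n.
rewrite -rmorphM; apply: le_trans (norm_natDa m.+1); rewrite lecR /=.
by rewrite mulrDl mul1r divfK // pnatr_eq0.
Qed.

Lemma norm_coeff_weight p q : (p <= q)%N ->
  `|coeff a p / weight (coeff a) a q| <= ((s * rise s q)^-1)%:C.
Proof.
move=> pq; have r0 : 0 < s * rise s q by rewrite mulr_gt0 ?rise_gt0 // ltW.
have w0 : 0 < `|weight (coeff a) a q|.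
  by rewrite normr_gt0 mulf_neq0 ?natDa_neq0 // coeff_neq0 //; apply: natDa_neq0.
rewrite normf_div ler_pdivrMr // fmorphV mulrC ler_pdivlMr ?ltcR //.
by rewrite mulrC norm_weight.
Qed.

Definition majorant ms : R := \prod_(m <- ms) harmonic m / rise s (last 0%N ms).

Lemma majorant_ge0 ms : 0 <= majorant ms.
Proof. by rewrite divr_ge0 ?prod_harmonic_ge0 // ltW ?rise_gt0 // ltW. Qed.

(** For a fixed last entry $q$ the other [r] variables are released from their order and range up to
    $q$, giving the [r]-th power of a harmonic sum; [sum_harmonic_expr_rise] then bounds the sum
    over $q$. *)
Lemma sum_majorant_bounded r : exists B : R, forall N,
  list_sum r.+1 N (fun ms => if sorted leq ms then majorant ms else 0) <= B.
Proof.
have [B hB] := sum_harmonic_expr_rise r step_bounds.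
exists B => N; apply: le_trans (hB N).
rewrite list_sum_rcons list_sum_sum; apply: ler_sum_nat => q /andP[_ qN].
have hr0 : 0 <= harmonic q / rise s q.
  by rewrite divr_ge0 ?harmonic_ge0 // ltW ?rise_gt0 // ltW.
rewrite [leRHS](_ : _ = harmonic q / rise s q * series harmonic q.+1 ^+ r); last by ring.
rewrite -list_sum_prod -list_sumZ -(list_sum_all_lt _ _ qN).
apply: le_list_sum => ms _ _; case: ifP => [|_]; last first.
  by case: ifP => // _; rewrite mulr_ge0 ?prod_harmonic_ge0.
rewrite (sorted_pairwise leq_trans) pairwise_rcons.
case/andP=> ms_q _; rewrite (_ : all (gtn q.+1) ms = true); last first.
  by apply: sub_all ms_q => m /=; rewrite ltnS.
rewrite /majorant last_rcons -cats1 big_cat /= big_seq1.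
by rewrite le_eqVlt; apply/orP; left; apply/eqP; ring.
Qed.

(** The [e]-chains are among the weak chains, so the increments are dominated by those of the
    bounded sums of [majorant]. *)
Lemma is_cvg_chain_psum (e : rel nat) r (F : seq nat -> R[i]) (C : R) :
    (forall x y, e x y -> (x <= y)%N) -> 0 <= C ->
    (forall ms, size ms = r.+1 -> sorted leq ms ->
       `|F ms| <= (C * majorant ms)%:C) ->
  cvgn ((fun N => chain_psum e r.+1 N F) : nat -> R[i]^o).
Proof.
move=> e_leq C0 FC; have [B hB] := sum_majorant_bounded r.
pose G ms : R := if sorted leq ms then C * majorant ms else 0.
apply: (@is_cvg_complex_dominated _ _ (fun N => list_sum r.+1 N G) (C * B)).
  move=> M N MN; rewrite raddfB !(list_sum_raddf (real_complex R)).
  apply: norm_list_sumB => // ms rms; rewrite /G.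
  case: ifP => [/(sub_sorted e_leq) ms_le|_]; first by rewrite ms_le FC.
  by rewrite normr0 ler0c; case: ifP => // _; rewrite mulr_ge0 ?majorant_ge0.
move=> N; apply: le_trans (ler_wpM2l C0 (hB N)).
rewrite -list_sumZ; apply: le_list_sum => ms _ _; rewrite /G.
by case: ifP; rewrite ?mulr0.
Qed.

(** The factor $1/(q+a)$ of the last variable is used up in $w_q$; by [1 < k'] a factor $1/(q+b)$ is
    left to supply [harmonic q]. *)
Lemma is_cvg_ZI (e : rel nat) k l k' :
    (forall x y, e x y -> (x <= y)%N) ->
    (0 < k)%N -> all (leq 1) l -> (1 < k')%N ->
  cvgn ((fun N => chain_psum e (size l).+2 N (termI a b (k :: rcons l k')))
    : nat -> R[i]^o).
Proof.
move=> e_leq k0 l0 k1; have [D D1 aD] := inv_bounds.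
have D0 : 0 < D by apply: lt_le_trans D1.
apply: (is_cvg_chain_psum (C := D ^+ k * D ^+ sumn l * D ^+ (k' - 1) / s)) => //.
  by rewrite !mulr_ge0 ?exprn_ge0 ?invr_ge0 // ltW.
move=> [//|p ms] [rms]; case/lastP: ms rms => [//|ms q].
rewrite size_rcons => -[rms] pq.
have {}pq : (p <= q)%N.
  have /allP := order_path_min leq_trans pq.
  by apply; rewrite mem_rcons mem_head.
rewrite termIE // (_ : _ * _ * _ = coeff a p / weight (coeff a) a q
  * ((p%:R + b) ^+ k)^-1 * facs a b l ms * ((q%:R + b) ^+ (k' - 1))^-1); last first.
  by rewrite /weight /fac !div1r (invfM (coeff a q)) (invfM (q%:R + a)); ring.
rewrite normrM [X in X * _]normrM (normrM (_ / _)).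
have k1' : (0 < k' - 1)%N by rewrite subn_gt0.
have B1 := norm_coeff_weight pq.
have B2 : `|((p%:R + b) ^+ k)^-1| <= (D ^+ k * harmonic p)%:C.
  by apply: le_trans (norm_invbX D1 aD _ _) _; rewrite lecR bound_expr.
have B3 := norm_facs D1 aD (esym rms) l0.
have B4 : `|((q%:R + b) ^+ (k' - 1))^-1| <= (D ^+ (k' - 1) * harmonic q)%:C.
  by apply: le_trans (norm_invbX D1 aD _ _) _; rewrite lecR bound_expr.
have := ler_pM _ _ (ler_pM _ _ (ler_pM _ _ B1 B2) B3) B4.
rewrite ?mulr_ge0 ?normr_ge0 // => /(_ isT isT isT isT isT isT) /le_trans; apply.
rewrite -!rmorphM lecR /majorant last_cons last_rcons big_cons -cats1 big_cat big_seq1.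
rewrite [X in X <= _](_ : _ = D ^+ k * D ^+ sumn l * D ^+ (k' - 1) / s
  * ((harmonic p * (\prod_(m <- ms) harmonic m * harmonic q)) / rise s q)) //.
by rewrite invfM; ring.
Qed.

Lemma is_cvg_ZII (e : rel nat) k l :
    (forall x y, e x y -> (x <= y)%N) -> all (leq 1) (rcons l k) ->
  cvgn ((fun N => chain_psum e (size l).+1 N (termII a b (rcons l k.+1)))
    : nat -> R[i]^o).
Proof.
move=> e_leq l0; have [D D1 aD] := inv_bounds.
have D0 : 0 < D by apply: lt_le_trans D1.
apply: (is_cvg_chain_psum (C := D ^+ sumn (rcons l k) / s)) => //.
  by rewrite !mulr_ge0 ?exprn_ge0 ?invr_ge0 // ltW.
move=> ms; case/lastP: ms => [//|ms q].
rewrite size_rcons => -[rms] ms_s.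
have pq : (head 0%N (rcons ms q) <= q)%N.
  case: ms ms_s {rms} => [//|p ms] /= pq.
  have /allP := order_path_min leq_trans pq.
  by apply; rewrite mem_rcons mem_head.
rewrite (@termIIE R a b k l _ ms q (esym rms) erefl) (normrM (_ / _)).
have B1 := norm_coeff_weight pq.
have sz : size (rcons l k) = size (rcons ms q) by rewrite !size_rcons rms.
have B2 := norm_facs D1 aD sz l0.
apply: le_trans (ler_pM (normr_ge0 _) (normr_ge0 _) B1 B2) _.
rewrite -!rmorphM lecR /majorant last_rcons.
rewrite le_eqVlt; apply/orP; left; apply/eqP.
by rewrite invfM; ring.
Qed.

(** A chain sum of length one: each power supplies a factor $1/(m+1)$, and one of the two is at most
    the inverse of [rise s m] by [rise_le_nat]. *)
Lemma is_cvg_Zab k j : (0 < k)%N -> (0 < j)%N ->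
  cvgn (series (fun m => 1 / ((m%:R + a) ^+ k * (m%:R + b) ^+ j) : R[i]^o)).
Proof.
move=> k0 j0; have [D D1 aD] := inv_bounds.
have D0 : 0 < D by apply: lt_le_trans D1.
rewrite (_ : series _ = (fun N => chain_psum leq 1 N (fun ms =>
    1 / (((head 0%N ms)%:R + a) ^+ k * ((head 0%N ms)%:R + b) ^+ j)) : R[i]^o)) //.
apply: (is_cvg_chain_psum (C := D ^+ k * D ^+ j)) => //.
  by rewrite mulr_ge0 ?exprn_ge0 // ltW.
move=> [//|m [|//]] _ _; rewrite div1r invfM normrM /majorant big_seq1.
have aX : `|((m%:R + a) ^+ k)^-1| <= (D ^+ k * harmonic m)%:C.
  apply: (@le_trans _ _ (((D * harmonic m) ^+ k)%:C)); last first.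
    by rewrite lecR bound_expr.
  rewrite -exprVn normrX rmorphXn /= lerXn2r ?nnegrE ?normr_ge0 //.
    by rewrite ler0c mulr_ge0 ?harmonic_ge0 // ltW.
  by case: (aD m).
have bX : `|((m%:R + b) ^+ j)^-1| <= (D ^+ j * harmonic m)%:C.
  by apply: le_trans (norm_invbX D1 aD _ _) _; rewrite lecR bound_expr.
apply: le_trans (ler_pM (normr_ge0 _) (normr_ge0 _) aX bX) _.
rewrite -rmorphM lecR mulrACA ler_wpM2l ?mulr_ge0 ?exprn_ge0 ?(ltW D0) //.
rewrite ler_wpM2l ?harmonic_ge0 //= lef_pV2 ?posrE ?ltr0n ?rise_gt0 ?(ltW s_gt0) //.
by rewrite rise_le_nat // (ltW s_gt0).
Qed.

Lemma sum_harmonic_rev M :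
  \sum_(0 <= p < M) harmonic (M - p.+1)%N = series harmonic M :> R.
Proof. by rewrite /series /= [RHS]big_nat_rev /= add0n. Qed.

(** The kernel is $(u_p/w_M)(M+a)/(M-p)$, and [harmonic (M - p.+1)] stands for $1/(M-p)$. *)
Lemma norm_kerB p M : (p < M)%N ->
  `|kerB (coeff a) p M|
    <= ((s * rise s M)^-1
        * ((1 + complex.Re `|a|) * M.+1%:R * harmonic (M - p.+1)%N))%:C.
Proof.
move=> pM; have A0 : 0 <= complex.Re `|a| by rewrite -lecR Re_normK normr_ge0.
have -> : kerB (coeff a) p M = coeff a p / weight (coeff a) a M
    * ((M%:R + a) * (M%:R - p%:R)^-1).
  rewrite /kerB /weight; have Ma0 := natDa_neq0 M.
  have cM0 := coeff_neq0 natDa_neq0 M.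
  by field; rewrite Ma0 cM0 natrB_neq0.
rewrite (normrM (_ / _)) [X in _ <= X]rmorphM.
apply: ler_pM; rewrite ?normr_ge0 ?norm_coeff_weight ?(ltnW pM) //.
rewrite normrM [X in _ <= X]rmorphM; apply: ler_pM; rewrite ?normr_ge0 //.
  apply: le_trans (ler_normD _ _) _; rewrite norm_natc -Re_normK -rmorphD lecR.
  by rewrite -natr1 mulrDl mul1r mulrDr mulr1; have := mulr_ge0 A0 (ler0n R M); lra.
rewrite -natrB ?(ltnW pM) // normfV norm_natc -fmorphV lecR /=.
by rewrite subnSK.
Qed.

(** For $p<m$ the factor [harmonic m] is at most [harmonic p], which against $(M+1)/(M-p)$ leaves
    only harmonic sums. *)
Lemma norm_ker_err : exists2 E : R, 0 <= E & forall M m, (m <= M)%N ->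
  (harmonic m)%:C * `|ker_err (coeff a) a M m|
    <= (E * (series harmonic M.+1 / rise s M))%:C.
Proof.
set A : R := 1 + complex.Re `|a|.
have A0 : 0 < A by rewrite ltr_wpDr // -lecR Re_normK normr_ge0.
(* Two harmonic sums contribute [2 * A], and the term $u_m/w_M$ contributes 1. *)
exists ((2 * A + 1) / s) => [|M m mM].
  by rewrite divr_ge0 ?(ltW s_gt0) //; lra.
have r0 : 0 < s * rise s M by rewrite mulr_gt0 ?rise_gt0 // ltW.
have h0 : (0 : R[i]) <= (harmonic m)%:C by rewrite ler0c harmonic_ge0.
have B : `|ker_err (coeff a) a M m| <= ((s * rise s M)^-1
    * (\sum_(0 <= p < m) A * M.+1%:R * harmonic (M - p.+1)%N + 1))%:C.
  rewrite mulrDr mulr1 rmorphD /= mulr_sumr rmorph_sum.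
  apply: le_trans (ler_normD _ _) _; apply: lerD (norm_coeff_weight mM).
  apply: le_trans (ler_norm_sum _ _ _) _; apply: ler_sum_nat => p /andP[_ pm].
  exact: norm_kerB (leq_trans pm mM).
apply: le_trans (ler_wpM2l h0 B) _; rewrite -rmorphM lecR.
rewrite mulrCA [leRHS](_ : _ = (s * rise s M)^-1
  * ((2 * A + 1) * series harmonic M.+1)); last by rewrite invfM; ring.
rewrite ler_wpM2l ?invr_ge0 ?(ltW r0) // mulrDr mulr1.
have H1 : 1 <= series harmonic M.+1 :> R.
  rewrite /series /= big_nat_recl //= invr1 lerDl.
  by apply: sumr_ge0 => l _; rewrite invr_ge0.
have HM : series harmonic M <= series harmonic M.+1 :> R.
  by rewrite seriesSr lerDl harmonic_ge0.
suff S : harmonic m * (\sum_(0 <= p < m) A * M.+1%:R * harmonic (M - p.+1)%N)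
    <= A * (series harmonic M + series harmonic M).
  have := ler_wpM2l (ltW A0) HM; have := @harmonic_le1 R m; lra.
(* [(M+1) / ((p+1) (M-p)) = 1 / (p+1) + 1 / (M-p)] *)
have P p : (p < M)%N ->
    harmonic p * (A * M.+1%:R * harmonic (M - p.+1)%N)
    = A * (harmonic (M - p.+1)%N + harmonic p) :> R.
  move=> pM /=; rewrite subnSK // natrB ?(ltnW pM) //.
  have n1 : M%:R - p%:R != 0 :> R by apply: natrB_neq0.
  have n2 : p%:R + 1 != 0 :> R by rewrite natr1 pnatr_eq0.
  by rewrite -!natr1; field; rewrite n1 n2.
rewrite -{1}sum_harmonic_rev /series /= -big_split /= mulr_sumr [leRHS]mulr_sumr.
rewrite [leRHS](big_cat_nat (n := m)) //= ler_wpDr //.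
  apply: sumr_ge0 => p _.
  by rewrite mulr_ge0 ?(ltW A0) // addr_ge0 ?invr_ge0.
apply: ler_sum_nat => p /andP[_ pm].
rewrite -[leRHS]P ?(leq_trans pm) // ler_wpM2r //.
  by rewrite !mulr_ge0 ?harmonic_ge0 // ltW.
by rewrite /= lef_pV2 ?posrE ?ltr0n // ler_nat ltnW.
Qed.

(** The surplus factor from [norm_facs2] lets [norm_ker_err] bound the error by one harmonic sum $H$
    over [rise]; releasing the order of the [r] variables gives $H^r$ more. So
    [cvg_harmonic_expr_rise] applies with exponent [r.+1]. *)
Lemma cvg_chain_psum_err (e : rel nat) ks :
    (forall x y, e x y -> (x <= y)%N) ->
    (0 < size ks)%N -> all (leq 1) ks -> has (leq 2) ks ->
  ((fun M => \sum_(0 <= i < size ks) chain_psum e (size ks) M.+1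
      (fun ms => facs a b (rot i ks) ms * ker_err (coeff a) a M (head 0%N ms)))
    : nat -> R[i]^o) @ \oo --> (0 : R[i]^o).
Proof.
move=> e_leq ks0 ks1 ks2; have [D D1 aD] := inv_bounds.
have D0 : 0 < D by apply: lt_le_trans D1.
have [E E0 hE] := norm_ker_err.
pose r := size ks.
pose x M : R := series harmonic M.+1 ^+ r.+1 / rise s M.
pose C : R := (D ^+ sumn ks * E) *+ r.
apply: (cvg0_norm_le (x := fun M => C * x M)); last first.
  rewrite -[X in _ --> X](mulr0 C); apply: cvgM; first exact: cvg_cst.
  exact: cvg_harmonic_expr_rise step_bounds.
move=> M; apply: le_trans (ler_norm_sum _ _ _) _.
rewrite /C mulrnAl -[X in _ *+ X](subn0 r) -sumr_const_nat rmorph_sum.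
apply: ler_sum_nat => i _.
apply: le_trans (norm_list_sum _ _ _) _.
have -> : D ^+ sumn ks * E * x M = list_sum r M.+1 (fun ms =>
    D ^+ sumn ks * E * (series harmonic M.+1 / rise s M)
    * \prod_(m <- ms) harmonic m).
  by rewrite list_sumZ list_sum_prod /x exprS /series; ring.
rewrite (list_sum_raddf (real_complex R)); apply: le_list_sum => ms rms ms_lt.
have maj0 : 0 <= D ^+ sumn ks * E * (series harmonic M.+1 / rise s M)
    * \prod_(m <- ms) harmonic m.
  rewrite mulr_ge0 ?prod_harmonic_ge0 // !mulr_ge0 ?exprn_ge0 ?(ltW D0) //.
    by apply: sumr_ge0 => l _; rewrite harmonic_ge0.
  by rewrite invr_ge0 ltW ?rise_gt0 // ltW.
case: ifP => [/(sub_sorted e_leq) ms_le|_]; last by rewrite normr0 ler0c.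
rewrite normrM.
have sz : size (rot i ks) = size ms by rewrite size_rot rms.
have rot1 : all (leq 1) (rot i ks) by rewrite (eq_all_r (mem_rot i ks)).
have rot2 : has (leq 2) (rot i ks) by rewrite (eq_has_r (mem_rot i ks)).
have hd : all (leq (head 0%N ms)) ms.
  case: ms ms_le {rms ms_lt maj0 sz} => [//|m ms] /= ms_le.
  by rewrite leqnn (order_path_min leq_trans).
have hdM : (head 0%N ms <= M)%N.
  case: ms ms_lt {rms ms_le maj0 sz hd} => [//|m ms] /= /andP[].
  by rewrite ltnS.
apply: le_trans (ler_wpM2r (normr_ge0 _) (norm_facs2 D1 aD sz rot1 rot2 hd)) _.
have rcM (y z : R) : (y * z)%:C = y%:C * z%:C by exact: rmorphM.
rewrite (rcM _ (harmonic _)) -[leLHS]mulrA.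
have P0 : (0 : R[i]) <= (D ^+ sumn (rot i ks) * \prod_(m <- ms) harmonic m)%:C.
  by rewrite ler0c mulr_ge0 ?prod_harmonic_ge0 // exprn_ge0 // ltW.
apply: le_trans (ler_wpM2l P0 (hE _ _ hdM)) _.
rewrite -rmorphM lecR sumn_rot.
by rewrite le_eqVlt; apply/orP; left; apply/eqP; ring.
Qed.

End Estimates.

(** * Passage to the limit and the two identities *)

Section Assembly.
Local Open Scope classical_set_scope.
Context {R : realType}.
Implicit Types (ks ms l : seq nat).

Lemma cvg_sum_nat {K : numFieldType} {V : normedModType K}
    (f : nat -> nat -> V) (l : nat -> V) n :
    (forall i, (i < n)%N -> f i @ \oo --> l i) ->
  (fun N => \sum_(0 <= i < n) f i N) @ \oo --> \sum_(0 <= i < n) l i.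
Proof.
elim: n => [|n IH] fl.
  by rewrite big_geq // (_ : (fun N => _) = fun=> 0);
    [exact: cvg_cst | apply/funext => N; rewrite big_geq].
rewrite big_nat_recr //= (_ : (fun N => _) = fun N => \sum_(0 <= i < n) f i N + f n N).
  by apply: cvgD; [apply: IH => i /leqW; apply: fl | apply: fl].
by apply/funext => N; rewrite big_nat_recr.
Qed.

(** Chains with entries at most [M] belong to the truncation [M.+1], while the error is indexed by
    [M]; hence the shift. *)
Lemma cvg_eq_shift {K : numFieldType} {V : normedModType K} (X Y E : nat -> V) (x y : V) :
    X @ \oo --> x -> Y @ \oo --> y -> E @ \oo --> (0 : V) ->
    (forall M, X M.+1 = Y M.+1 - E M) ->
  x = y.
Proof.
move=> cX cY cE XYE.
have cX' : (X \o addn 1) @ \oo --> x by exact: (cvg_comp _ _ (cvg_addnl 1) cX).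
have cY' : (Y \o addn 1) @ \oo --> y by exact: (cvg_comp _ _ (cvg_addnl 1) cY).
have cYE : (fun M => (Y \o addn 1) M - E M) @ \oo --> y - 0 by exact: cvgB.
rewrite subr0 in cYE.
have eqX : X \o addn 1 = (fun M => (Y \o addn 1) M - E M).
  by apply/funext => M; exact: XYE.
rewrite eqX in cX'.
have Hx := cvg_lim (@norm_hausdorff _ _) cX'.
have Hy := cvg_lim (@norm_hausdorff _ _) cYE.
by rewrite -Hx -Hy.
Qed.

Lemma cvg_lin_comb {K : numFieldType} {V : normedModType K} (x y : K)
    (f g : nat -> V) (l l' : V) : f @ \oo --> l -> g @ \oo --> l' ->
  (fun N => x *: f N + y *: g N) @ \oo --> x *: l + y *: l'.
Proof. by move=> fl gl; apply: cvgD; apply: cvgZl_tmp. Qed.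

Lemma chain_sumE (e : rel nat) r (F : seq nat -> R[i]) :
  chain_sum e r F = limn ((fun N => chain_psum e r N F) : nat -> R[i]^o).
Proof.
rewrite /chain_sum; set f := (fun N => _); set g := (fun N => chain_psum _ _ _ _).
suff -> : f = g by [].
by apply/funext => N; exact: (sum_tupleE r N (sorted e) F).
Qed.

Lemma chain_psum_diag r N (F : seq nat -> R[i]) :
  chain_psum leq r.+1 N
    (fun ms => if head 0%N ms == last 0%N ms then F ms else 0)
  = \sum_(0 <= m < N) F (nseq r.+1 m).
Proof.
rewrite -list_sum_constant; apply: eq_list_sum => ms _ _.
case: ifP => [ms_le|ms_le]; first by rewrite sorted_leq_headP.
case: ifP => // /all_pred1P ms_eq; move: ms_le; rewrite {1}ms_eq.
case: (size ms) => //= n; suff -> : path leq (head 0%N ms) (nseq n (head 0%N ms)) by [].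
by elim: n => //= n ->; rewrite leqnn.
Qed.

Lemma sum_subn1 ks : all (leq 1) ks ->
  (\sum_(k <- ks) k = \sum_(k <- ks) (k - 1) + size ks)%N.
Proof.
elim: ks => [|k ks IH] /=; first by rewrite !big_nil.
by case/andP=> k1 /IH IHk; rewrite !big_cons IHk; lia.
Qed.

Context (a b : R[i]).
Hypothesis a_gt0 : 0 < complex.Re a.
Hypothesis b_notin : forall m : nat, b <> - m%:R.
Variable ks : seq nat.
Hypothesis ks_gt0 : (0 < size ks)%N.
Hypothesis ks_ge1 : all (leq 1) ks.
Hypothesis ks_ge2 : has (leq 2) ks.

Let k_ i := nth 0%N ks i.

Let k_gt0 i : (i < size ks)%N -> (0 < k_ i)%N.
Proof. by move=> ik; move/all_nthP: ks_ge1; apply. Qed.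

Let cyc_ge1 i : all (leq 1) (cyc_others ks i).
Proof.
apply/allP => m; rewrite mem_cat => /orP[/mem_drop|/mem_take];
  exact: (allP ks_ge1).
Qed.

Lemma cvg_lhs (e : rel nat) : (forall x y, e x y -> (x <= y)%N) ->
  ((fun N => \sum_(0 <= i < size ks) \sum_(0 <= j < (k_ i).-1)
     chain_psum e (size ks).+1 N
       (termI a b (j.+1 :: rcons (cyc_others ks i) (k_ i - j)%N)))
    : nat -> R[i]^o) @ \oo -->
  (\sum_(0 <= i < size ks) \sum_(0 <= j < (k_ i).-1)
     chain_sum e (size (j.+1 :: rcons (cyc_others ks i) (k_ i - j)%N))
       (termI a b (j.+1 :: rcons (cyc_others ks i) (k_ i - j)%N)) : R[i]^o).
Proof.
move=> e_leq; apply: cvg_sum_nat => i ik; apply: cvg_sum_nat => j jk.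
rewrite chain_sumE /= size_rcons size_cyc_others // prednK //.
have := @is_cvg_ZI R a b a_gt0 b_notin e j.+1 (cyc_others ks i) (k_ i - j)%N e_leq.
rewrite size_cyc_others // prednK //; apply=> //.
by move: (k_gt0 ik) jk; lia.
Qed.

Lemma cvg_rhs_II :
  ((fun N => \sum_(0 <= i < size ks)
     chain_psum ltn (size ks) N (termII a b (rcons (cyc_others ks i) (k_ i).+1)))
    : nat -> R[i]^o) @ \oo -->
  (\sum_(0 <= i < size ks) ZII (rcons (cyc_others ks i) (k_ i).+1) a b : R[i]^o).
Proof.
apply: cvg_sum_nat => i ik; rewrite /ZII chain_sumE size_rcons size_cyc_others //.
have := @is_cvg_ZII R a b a_gt0 b_notin ltn (k_ i) (cyc_others ks i).
rewrite size_cyc_others // prednK //; apply=> //; first exact: ltnW.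
by rewrite all_rcons cyc_ge1 k_gt0.
Qed.

Lemma cyclic_sum_ZI :
  \sum_(0 <= i < size ks) \sum_(0 <= j < (k_ i).-1)
     ZI (j.+1 :: rcons (cyc_others ks i) (k_ i - j)%N) a b
  = \sum_(0 <= i < size ks) ZII (rcons (cyc_others ks i) (k_ i).+1) a b.
Proof.
have cL := @cvg_lhs ltn (fun x y => @ltnW x y).
have cR := cvg_rhs_II.
have cE := @cvg_chain_psum_err R a b a_gt0 b_notin ltn ks
  (fun x y => @ltnW x y) ks_gt0 ks_ge1 ks_ge2.
apply: (cvg_eq_shift cL cR cE) => M.
rewrite (cyclic_sum_finite (natDa_neq0 a_gt0) (natDb_neq0 b_notin)
  (e := ltn) (diag := fun m c => coeff a m / weight (coeff a) a c)) //.
- rewrite [X in _ + X = _]big1_seq ?addr0.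
    (* Rotation by [i.+1] puts $k_i$ last, as [termIIE] requires. *)
    congr (_ - _); rewrite -(sum_rotS ks (fun l => chain_psum ltn (size ks) M.+1
      (fun ms => facs a b l ms
        * (coeff a (head 0%N ms) / weight (coeff a) a (last 0%N ms))))).
    apply: eq_big_nat => i /andP[_ ik]; apply: eq_chain_psum => ms rms _ _.
    case/lastP: ms rms => [rms|ms q]; first by move: ks_gt0; rewrite -rms.
    rewrite size_rcons => rms; rewrite (@termIIE R a b (k_ i) _ _ ms q _ erefl).
      by rewrite rotS_cyc_others // last_rcons mulrC.
    by rewrite size_cyc_others // -rms.
  (* A strict chain of length at least 2 has its first entry below its last, so the terms with $p=q$
     are absent. *)
  move=> i _; rewrite -[RHS](list_sum0 (size ks).+1 M.+1).
  apply: eq_list_sum => ms rms _; case: ifP => // ms_lt.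
  rewrite ltn_eqF //; case: ms rms ms_lt => [//|m [|x ms]] [rms] /=.
    by move: ks_gt0; rewrite -rms.
  case/andP => mx x_ms; apply: leq_trans mx _.
  case: ms x_ms {rms} => [//|y ms] x_ms.
  have /allP := order_path_min ltn_trans x_ms.
  by move=> /(_ _ (mem_last y ms)) /= /ltnW.
- exact: ltnW.
- move=> m c mcM; apply: kernel_ltn => //.
  + exact: (coeff_neq0 (natDa_neq0 a_gt0)).
  + exact: natDa_neq0.
  + exact: coeffS.
Qed.

Let n := size ks.
(** This is $k-n$, the exponent of $m+b$ in [facs_rot]. It is positive because some $k_i\ge2$, as
    [is_cvg_Zab] asks for the exponents [n.+1] and [d]. *)
Let d := (\sum_(k <- ks) (k - 1))%N.

Let d_gt0 : (0 < d)%N.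
Proof.
rewrite lt0n /d sum_nat_seq_eq0 -has_predC; apply: sub_has ks_ge2 => k /=.
by rewrite -lt0n subn_gt0.
Qed.

Let sum_rot_subn1 i : (\sum_(k <- rot i ks) (k - 1) = d)%N.
Proof. by apply: perm_big; rewrite perm_rot. Qed.

Let facs_rot i m :
  facs a b (rot i ks) (nseq n m)
  = 1 / ((m%:R + a) ^+ n * (m%:R + b) ^+ d).
Proof.
by rewrite -(sum_rot_subn1 i) /n -(size_rot i) facs_nseq.
Qed.

Let facs_cyc i m : (i < n)%N ->
  facs a b (rcons (cyc_others ks i) (k_ i).+1) (nseq n m)
  = 1 / ((m%:R + a) ^+ n * (m%:R + b) ^+ d.+1).
Proof.
move=> ik.
have sz : size (rcons (cyc_others ks i) (k_ i).+1) = n.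
  by rewrite size_rcons size_cyc_others // prednK.
rewrite -{1}sz facs_nseq sz; congr (1 / (_ * _ ^+ _)).
rewrite -(sum_rot_subn1 i.+1) rotS_cyc_others // -!cats1 !big_cat !big_seq1 /= -/(k_ i).
by have := k_gt0 ik; lia.
Qed.

Let sum_pred : (\sum_(0 <= i < n) (k_ i).-1 = d)%N.
Proof.
by rewrite /d [RHS](big_nth 0%N); apply: eq_bigr => i _; rewrite subn1.
Qed.

Let zab p q m : R[i] := 1 / ((m%:R + a) ^+ p * (m%:R + b) ^+ q).

Lemma cvg_rhs_star :
  ((fun N => d%:R * series (zab n d.+1) N + n%:R * series (zab n.+1 d) N)
    : nat -> R[i]^o) @ \oo -->
  (d%:R * Zab n d.+1 a b + n%:R * Zab n.+1 d a b : R[i]^o).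
Proof.
have c1 : (series (zab n d.+1) : nat -> R[i]^o) @ \oo --> (Zab n d.+1 a b : R[i]^o).
  exact: (is_cvg_Zab a_gt0 b_notin).
have c2 : (series (zab n.+1 d) : nat -> R[i]^o) @ \oo --> (Zab n.+1 d a b : R[i]^o).
  exact: (is_cvg_Zab a_gt0 b_notin).
exact: (cvg_lin_comb (x := d%:R) (y := n%:R) c1 c2).
Qed.

Lemma cyclic_sum_ZstarI :
  \sum_(0 <= i < size ks) \sum_(0 <= j < (k_ i).-1)
     ZstarI (j.+1 :: rcons (cyc_others ks i) (k_ i - j)%N) a b
  = d%:R * Zab n d.+1 a b + n%:R * Zab n.+1 d a b.
Proof.
have cL := @cvg_lhs leq (fun x y => id).
have cE := @cvg_chain_psum_err R a b a_gt0 b_notin leq ks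
  (fun x y => id) ks_gt0 ks_ge1 ks_ge2.
apply: (cvg_eq_shift cL cvg_rhs_star cE) => M.
rewrite (cyclic_sum_finite (natDa_neq0 a_gt0) (natDb_neq0 b_notin) (e := leq)
  (diag := fun m c => if m == c then (m%:R + a)^-1 else 0)) //; last first.
  move=> m c mcM; apply: kernel_leq => //.
  - exact: (coeff_neq0 (natDa_neq0 a_gt0)).
  - exact: natDa_neq0.
  - exact: coeffS.
rewrite addrAC; congr (_ - _); rewrite addrC; congr (_ + _).
  (* The terms with $p=q$: for each $i$ they give $k_i-1$ copies of one series, and these numbers
     add up to $k-n$. *)
  transitivity (\sum_(0 <= i < n) (k_ i).-1%:R * series (zab n d.+1) M.+1); last first.
    by rewrite -mulr_suml -natr_sum sum_pred.
  apply: eq_big_nat => i /andP[_ ik].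
  rewrite (chain_psum_diag (size ks) M.+1 (fun ms => (k_ i).-1%:R
    * facs a b (rcons (cyc_others ks i) (k_ i).+1) (behead ms))).
  rewrite -mulr_sumr; congr (_ * _); apply: eq_bigr => m _.
  exact: facs_cyc.
(* The diagonal of the kernel identity: each of the $n$ rotations gives the same series, with one
   more factor $1/(m+a)$. *)
rewrite (eq_bigr (fun=> series (zab n.+1 d) M.+1)).
  by rewrite sumr_const_nat subn0 mulr_natl.
move=> i _; rewrite -(prednK ks_gt0).
under [LHS]eq_chain_psum do rewrite (fun_if ( *%R _)) mulr0.
rewrite (chain_psum_diag _ M.+1 (fun ms => facs a b (rot i ks) ms
  * ((head 0%N ms)%:R + a)^-1)).
apply: eq_bigr => m _; rewrite prednK // facs_rot /zab.
have -> : head 0%N (nseq (size ks) m) = m by case: (size ks) ks_gt0.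
by rewrite !div1r -invfM exprSr; congr (_^-1); ring.
Qed.

End Assembly.

Theorem theorem1 (R : realType) (n : nat) (k : n.-tuple nat)
    (n_ge1 : (1 <= n)%N)
    (k_ge1 : forall i : 'I_n, (1 <= tnth k i)%N)
    (k_ge2 : exists i : 'I_n, (2 <= tnth k i)%N)
    (alpha beta : R[i])
    (alpha_gt0 : 0 < complex.Re alpha)
    (betaP : forall m : nat, beta <> - m%:R) :
  let K : nat := (\sum_(i < n) tnth k i)%N in
  (\sum_(i < n) \sum_(0 <= j < (tnth k i).-1)
      ZI (j.+1 :: rcons (cyc_others k i) (tnth k i - j)%N) alpha beta
   = \sum_(i < n) ZII (rcons (cyc_others k i) (tnth k i).+1) alpha beta)
  /\
  (\sum_(i < n) \sum_(0 <= j < (tnth k i).-1)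
      ZstarI (j.+1 :: rcons (cyc_others k i) (tnth k i - j)%N) alpha beta
   = (K%:Z - n%:Z)%:~R * Zab n%:Z (K%:Z - n%:Z + 1) alpha beta
     + n%:R * Zab (n%:Z + 1) (K%:Z - n%:Z) alpha beta).
Proof.
have sz : size k = n by apply: size_tuple.
have ks_gt0 : (0 < size k)%N by rewrite sz.
have ks_ge1 : all (leq 1) k by apply/all_tnthP.
have ks_ge2 : has (leq 2) k by apply/has_tnthP.
move=> K; pose d := (\sum_(j <- k) (j - 1))%N.
have KE : K = (d + n)%N.
  by rewrite /K -(big_tuple _ _ k xpredT id) (sum_subn1 ks_ge1) sz.
(* As every $k_i\ge1$, the integer $k-n$ is the natural number [d], and the integer powers in [Zab]
   become natural ones. *)
have -> : K%:Z - n%:Z = d%:Z by rewrite KE PoszD addrK.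
rewrite -PoszD addn1 -PoszD addn1; split.
  have := cyclic_sum_ZI alpha_gt0 betaP ks_gt0 ks_ge1 ks_ge2.
  rewrite sz !big_mkord => main.
  transitivity (\sum_(i < n) \sum_(0 <= j < (nth 0%N k i).-1)
    ZI (j.+1 :: rcons (cyc_others k i) (nth 0%N k i - j)%N) alpha beta).
    by apply: eq_bigr => i _; rewrite (tnth_nth 0%N).
  by rewrite main; apply: eq_bigr => i _; rewrite (tnth_nth 0%N).
have := cyclic_sum_ZstarI alpha_gt0 betaP ks_gt0 ks_ge1 ks_ge2.
rewrite sz !big_mkord => main; rewrite -[RHS]main.
by apply: eq_bigr => i _; rewrite (tnth_nth 0%N).
Qed.
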